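(* Suppose $U\in C^2(\mathbb R)$, $e^{-U}\in L^1(\mathbb R)$, there are $\delta\in(0,1)$, $a\in\mathbb R$, $A>0$ with $a\le U''(x)\le \delta|U'(x)|^2+A$ for all $x\in\mathbb R$, and there are constants $c_1,c_2\ge0$ such that the continuous function $\lambda_{\mathrm{refr}}:\mathbb R\to[0,\infty)$ satisfies $\lambda_{\mathrm{refr}}(x)\le c_1+c_2|U'(x)|$ for all $x$. Suppose further that $U(x)=U(-x)$ and $\lambda_{\mathrm{refr}}(x)=\lambda_{\mathrm{refr}}(-x)$ for all $x\in\mathbb R$. Let $L$ be the zigzag generator on $L^2(\mu)$ and $T$ the unitary operator on $L^2(\mu)$ given by $Tf(x,\theta)=\frac1{\sqrt2}\left(f^+(x)+\theta f^-(-x)\right)$. Then the transformation $\widetilde L=TLT^\star$ of $L$ by $T$ is given by $\mathcal D(\widetilde L)=W^{1,2}(\mu)$ and $$(\widetilde Lf)^\pm(x)=\partial_xf^\pm(x)+\lambda^+(x)\left(\pm f^\pm(-x)-f^\pm(x)\right),\quad f\in\mathcal D(\widetilde L).$$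
   Context: $E=\mathbb R\times\{-1,+1\}$; for $f:E\to\mathbb C$ write $f^{\pm}(x)=f(x,\pm1)$. $\lambda(x,\theta)=\max(\theta U'(x),0)+\lambda_{\mathrm{refr}}(x)$ for $(x,\theta)\in E$, and $\lambda^+(x)=\lambda(x,+1)$. The measure $\nu$ on $\mathbb R$ is $\nu(dx)=e^{-U(x)}dx$ and $\mu$ on $E$ is $\mu(A\times\{\theta\})=\nu(A)$. $L^2(\mu)$ is the complex Hilbert space of square integrable functions on $E$. $W^{1,2}(\mu)$ is the set of $f$ on $E$ such that $f^\pm\in L^2(\nu)$ have weak derivatives in $L^2(\nu)$. $W^{1,2}_{\mathrm{loc}}(E)$ is the set of $f$ with $f^{\pm}\in W^{1,2}_{\mathrm{loc}}(\mathbb R)$. The zigzag generator is $Lf(x,\theta)=\theta\,\partial_xf(x,\theta)+\lambda(x,\theta)(f(x,-\theta)-f(x,\theta))$ with domain $\mathcal D(L)=\{f\in L^2(\mu)\cap W^{1,2}_{\mathrm{loc}}(E): Lf\in L^2(\mu)\}$. The adjoint of $T$ is $T^\star f(x,\theta)=T^{-1}f(x,\theta)=\frac1{\sqrt2}(f(\theta x,+1)+\theta f(\theta x,-1))$, and $\widetilde L=TLT^\star$ has domain $\{f\in L^2(\mu):T^\star f\in\mathcal D(L)\}$. *)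

(* Defs.v *)
From HB Require Import structures.
From mathcomp Require Import all_boot all_order all_algebra.
From mathcomp Require Import complex.
From mathcomp Require Import all_classical all_reals all_analysis measurable_realfun ring.
Set Implicit Arguments.
Unset Strict Implicit.
Unset Printing Implicit Defensive.
Import Order.TTheory GRing.Theory Num.Theory.
Import numFieldNormedType.Exports.
Local Open Scope classical_set_scope.
Local Open Scope ring_scope.
Local Open Scope complex_scope.

(* The state space R x {-1,+1}: [true] encodes +1 and [false] encodes -1. *)
Definition zzE (R : realType) : Type := (measurableTypeR R * bool)%type.

Definition sgn {R : realType} (s : bool) : R := if s then 1 else -1.

Definition slice {R : realType} {V : Type} (f : zzE R -> V) (s : bool) : R -> V :=
  fun x => f (x, s).

Definition Cn {R : realType} (n : nat) (f : R -> R) : Prop :=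
  (forall k x, (k < n)%N -> derivable (f^`(k))%classic x 1) /\ continuous (f^`(n))%classic.

Lemma Cn_measurable {R : realType} n (f : R -> R) :
  Cn n f -> measurable_fun [set: R] f.
Proof.
case: n => [[_ cf]|n [df _]]; apply: continuous_measurable_fun => //.
by move=> x; apply: differentiable_continuous; apply/derivable1_diffP/(df 0%N).
Qed.

Section measures.
Context {R : realType} (U : R -> R) (mU : measurable_fun [set: R] U).

Local Notation leb := (@lebesgue_measure R).

(* nu(dx) = exp(-U(x)) dx; the unused proof argument is what the measure
   structure below is inferred from. *)
Definition nu (_ : measurable_fun [set: R] U) (A : set (R)) :
    \bar R :=
  (\int[leb]_(x in A) (expR (- U x))%:E)%E.

Let nu0 : nu mU set0 = 0%E.
Proof. by rewrite /nu integral_set0. Qed.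

Let nu_ge0 A : (0 <= nu mU A)%E.
Proof. by apply: integral_ge0 => x _; rewrite lee_fin expR_ge0. Qed.

Let nu_sigma_additive : semi_sigma_additive (nu mU).
Proof.
apply: (@semi_sigma_additive_nng_induced _ _ _ leb) => [|x]; last by rewrite lee_fin expR_ge0.
by apply/measurable_EFinP; apply: measurableT_comp => //; exact: measurableT_comp.
Qed.

HB.instance Definition _ := isMeasure.Build _ _ _ (nu mU)
  nu0 nu_ge0 nu_sigma_additive.

(* The measure on R x {-1,+1} such that mu (A x {s}) = nu A. *)
Definition mu (A : set (zzE R)) : \bar R :=
  (\sum_(s : bool) nu mU [set x | A (x, s)])%E.

Let measurable_slice (A : set (zzE R)) s :
  measurable A -> measurable [set x : measurableTypeR R | A (x, s)].
Proof.
by move=> mA; rewrite -[X in measurable X]setTI; exact: (pair2_measurable s).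
Qed.

Let mu0 : mu set0 = 0%E.
Proof. by rewrite /mu big1// => s _; exact: (@measure0 _ _ _ (nu mU)). Qed.

Let mu_ge0 A : (0 <= mu A)%E.
Proof. by apply: sume_ge0 => s _; exact: nu_ge0. Qed.

Let mu_sigma_additive : semi_sigma_additive mu.
Proof.
move=> F mF tF mUF.
have cvg_slice s : \sum_(0 <= i < n) nu mU [set x | F i (x, s)] @[n --> \oo]
    --> nu mU [set x | (\bigcup_i F i) (x, s)].
  rewrite (_ : [set x | _] = \bigcup_i [set x | F i (x, s)]) //.
  apply: (@measure_sigma_additive _ _ _ (nu mU) (fun i => [set x | F i (x, s)])).
    by move=> i; exact: measurable_slice.
  by move=> i j _ _ [x [Fi Fj]]; apply: (tF i j) => //; exists (x, s).
rewrite [X in X @ _ --> _](_ : _ =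
    (fun n => \sum_(0 <= i < n) nu mU [set x | F i (x, true)] +
              \sum_(0 <= i < n) nu mU [set x | F i (x, false)])%E); last first.
  by apply/funext => n; rewrite -big_split; apply: eq_bigr => i _; rewrite /mu big_bool.
rewrite /mu big_bool; apply: cvgeD; [|exact: cvg_slice|exact: cvg_slice].
by apply: ge0_adde_def; rewrite inE; exact: nu_ge0.
Qed.

HB.instance Definition _ := isMeasure.Build _ _ _ mu
  mu0 mu_ge0 mu_sigma_additive.

End measures.

Section complex_functions.
Context {R : realType} {d : measure_display} {X : measurableType d}.

Definition cmeasurable (D : set X) (f : X -> R[i]) : Prop :=
  measurable_fun D (fun x => complex.Re (f x)) /\
  measurable_fun D (fun x => complex.Im (f x)).

Definition cintegral (m : {measure set X -> \bar R}) (f : X -> R[i]) : R[i] :=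
  (\int[m]_(x in setT) complex.Re (f x)) +i*
  (\int[m]_(x in setT) complex.Im (f x)).

(* The functions f : X -> C which represent an element of L^2(D, m); two of
   them represent the same element when they agree m-almost everywhere. *)
Definition L2on (m : {measure set X -> \bar R}) (D : set X) : set (X -> R[i]) :=
  [set f | cmeasurable D f /\
    (\int[m]_(x in D) ((Normc.normc (f x)) ^+ 2)%:E < +oo)%E].

Definition L2 (m : {measure set X -> \bar R}) : set (X -> R[i]) := L2on m setT.

End complex_functions.

Section weak_derivative.
Context {R : realType}.
Local Notation leb := (@lebesgue_measure R).

Definition test_function : set (R -> R) :=
  [set phi | (forall n, Cn n phi) /\
    exists2 K : set R, compact K & forall x, ~ K x -> phi x = 0].

Definition L1loc : set (R -> R[i]) :=
  [set f | locally_integrable setT (fun x => complex.Re (f x)) /\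
           locally_integrable setT (fun x => complex.Im (f x))].

Definition L2loc : set (R -> R[i]) :=
  [set f | cmeasurable setT f /\ forall K, compact K -> L2on leb K f].

(* Real test functions suffice, as the identity is linear in phi. *)
Definition is_weak_derivative (f g : R -> R[i]) : Prop :=
  [/\ L1loc f, L1loc g & forall phi, test_function phi ->
    cintegral leb (fun x => f x * ((phi^`())%classic x)%:C) =
    - cintegral leb (fun x => g x * (phi x)%:C)].

(* A choice of weak derivative, which is unique up to a null set; the value is
   junk when f has no weak derivative. *)
Definition weak_derivative (f : R -> R[i]) : R -> R[i] :=
  xget (fun=> 0) [set g | is_weak_derivative f g].

Definition W12loc : set (R -> R[i]) :=
  [set f | L2loc f /\ exists g, is_weak_derivative f g /\ L2loc g].

Definition W12locE : set (zzE R -> R[i]) :=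
  [set f | forall s, W12loc (slice f s)].

Definition W12 (U : R -> R) (mU : measurable_fun setT U) :
    set (zzE R -> R[i]) :=
  [set f | forall s, L2 (nu mU) (slice f s) /\
    exists g, is_weak_derivative (slice f s) g /\ L2 (nu mU) g].

End weak_derivative.

Section zigzag.
Context {R : realType}.

Definition lambda (U lrefr : R -> R) (p : zzE R) : R :=
  Num.max (sgn p.2 * (U^`())%classic p.1) 0 + lrefr p.1.

(* Operators on L^2(mu) act on representatives; [weak_derivative] depends only
   on the almost everywhere class of its argument. *)
Definition zzL (U lrefr : R -> R) (f : zzE R -> R[i]) : zzE R -> R[i] :=
  fun p => (sgn p.2)%:C * weak_derivative (slice f p.2) p.1 +
    (lambda U lrefr p)%:C * (f (p.1, ~~ p.2) - f p).

Definition zzdom (U lrefr : R -> R) (mU : measurable_fun setT U) :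
    set (zzE R -> R[i]) :=
  [set f | [/\ L2 (mu mU) f, W12locE f & L2 (mu mU) (zzL U lrefr f)]].

Definition T (f : zzE R -> R[i]) : zzE R -> R[i] :=
  fun p => ((Num.sqrt 2)^-1)%:C *
    (slice f true p.1 + (sgn p.2)%:C * slice f false (- p.1)).

(* The adjoint of the unitary operator T, see [TK] and [TstarK]. *)
Definition Tstar (f : zzE R -> R[i]) : zzE R -> R[i] :=
  fun p => ((Num.sqrt 2)^-1)%:C *
    (f (sgn p.2 * p.1, true) + (sgn p.2)%:C * f (sgn p.2 * p.1, false)).

(* T L T*, with domain {f in L^2(mu) : T* f in D(L)}. *)
Definition zzLt (U lrefr : R -> R) (f : zzE R -> R[i]) : zzE R -> R[i] :=
  T (zzL U lrefr (Tstar f)).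

Definition zzLtdom (U lrefr : R -> R) (mU : measurable_fun setT U) :
    set (zzE R -> R[i]) :=
  [set f | L2 (mu mU) f /\ zzdom lrefr mU (Tstar f)].

Let half : ((Num.sqrt 2)^-1)%:C * ((Num.sqrt 2)^-1)%:C = 2^-1 :> R[i].
Proof.
by rewrite -rmorphM/= -invfM -expr2 sqr_sqrtr// fmorphV rmorph_nat.
Qed.

Let sgnC s : (sgn s)%:C = (if s then 1 else -1) :> R[i].
Proof. by case: s; rewrite /sgn ?rmorphN1 ?rmorph1. Qed.

Lemma TstarK : cancel Tstar T.
Proof.
move=> f; apply/funext => -[x s]; rewrite /T /Tstar /slice /= !sgnC /sgn.
rewrite !mul1r !mulN1r opprK (mulrCA (if s then _ else _)) -mulrDr mulrA half.
by case: s; field.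
Qed.

Lemma TK : cancel T Tstar.
Proof.
move=> f; apply/funext => -[x s]; rewrite /T /Tstar /slice /= !sgnC /sgn.
rewrite (mulrCA (if s then _ else _)) -mulrDr mulrA half.
by case: s; rewrite ?mulN1r ?mul1r ?opprK; field.
Qed.

End zigzag.

(* Main.v *)
Require Import Defs.
From mathcomp Require Import all_boot all_order all_algebra.
From mathcomp Require Import complex.
From mathcomp Require Import all_classical all_reals all_analysis.
From mathcomp Require Import measurable_realfun ring lra.
Import Order.TTheory GRing.Theory Num.Theory.
Import numFieldNormedType.Exports.
Local Open Scope classical_set_scope.
Local Open Scope ring_scope.
Local Open Scope complex_scope.

(* Conjugation by T turns the zigzag generator into two decoupled operators
   f |-> f' + lambda (sigma f(-.) - f), sigma = 1 or -1. Put
   h = f' + lambda (sigma f(-.) - f) and o = f - sigma f(-.). Since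
   lambda(x) - lambda(-x) = U'(x), one gets o' - U' o = h + sigma h(-.).
   Integrating by parts against exp(-U), int |o' - U' o|^2 = int |o'|^2 + U'' |o|^2,
   and U'' >= a bounds o', hence U' o and lambda o, hence f' = h + lambda o, in
   L^2(nu). Conversely U'' <= delta U'^2 + A gives the Hardy-type bound
   int |U' o|^2 <= C int (|o|^2 + |o'|^2), so h is in L^2(nu) when f and f' are.
   The integrations by parts are done on [-b, b] against the square of the cutoff
   1 - x^2 / b^2, using that a function with a weak derivative is almost
   everywhere a primitive of it. *)

Set Implicit Arguments.
Unset Strict Implicit.
Unset Printing Implicit Defensive.

(** * Smooth functions and bumps *)

(** The rate [lambda] is only continuous, because of the positive part and of [lrefr], so nothing
    can be integrated by parts against it. Passing to [h + sigma h(-.)] replaces it by [U'], which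
    is C^1 because [U] is C^2; this is why the energy identity is applied to [o] and not to [f].
    Neither [o'] nor [U' o] is known in advance to be square integrable at infinity, hence the
    cutoff. Its square is taken because the derivative of a square keeps one factor of the cutoff:
    the error is then a product of [cutoff * U' * o] and [cutoff' * o], which Young's inequality
    splits into an absorbable part and a multiple of [o^2]. Evenness serves twice: reflection
    preserves nu, and it gives both components of the conjugated operator the same rate [lambda^+].
    Since [sigma], [lambda] and [U'] are real, all estimates are made for real functions and applied
    to real and imaginary parts. *)

Section smooth_functions.
Context {R : realType}.
Implicit Types (f g : R -> R) (n : nat).

Lemma CnS n f :
  Cn n.+1 f <-> (forall x, derivable f x 1) /\ Cn n (f^`())%classic.
Proof.
split=> [[df cf]|[df [df' cf']]].
  split; first by move=> x; exact: (df 0%N).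
  split=> [k x kn|]; rewrite -derive1Sn//; exact: df.
split=> [[|k] x kn|]; rewrite ?derive1n0 ?derive1Sn//; exact: df'.
Qed.

Lemma CnW n f : Cn n.+1 f -> Cn n f.
Proof.
move=> [df cf]; split=> [k x kn|]; first by apply: df; exact: ltnW.
by move=> x; apply: differentiable_continuous; apply/derivable1_diffP/df.
Qed.

Lemma Cn_derivable n f x : Cn n.+1 f -> derivable f x 1.
Proof. by move=> /CnS[]. Qed.

Lemma Cn_continuous n f : Cn n f -> continuous f.
Proof. by elim: n f => [f []//|n IH f /CnW/IH]. Qed.

Lemma CnD n f g : Cn n f -> Cn n g -> Cn n (f \+ g).
Proof.
elim: n f g => [f g [_ cf] [_ cg]|n IH f g /CnS[df cf] /CnS[dg cg]].
  by split=> // x; apply: continuousD; [exact: cf|exact: cg].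
apply/CnS; split=> [x|]; first exact: derivableD.
suff -> : ((f \+ g)^`() = f^`() \+ g^`())%classic by exact: IH.
by apply/funext => x /=; rewrite !derive1E deriveD.
Qed.

Lemma CnM n f g : Cn n f -> Cn n g -> Cn n (f \* g).
Proof.
elim: n f g => [f g [_ cf] [_ cg]|n IH f g Cf Cg].
  by split=> // x; apply: continuousM; [exact: cf|exact: cg].
have [df cf] := (CnS _ _).1 Cf; have [dg cg] := (CnS _ _).1 Cg.
apply/CnS; split=> [x|]; first exact: derivableM.
suff -> : ((f \* g)^`() = (f \* g^`()) \+ (g \* f^`()))%classic.
  by apply: CnD; apply: IH => //; exact: CnW.
by apply/funext => x /=; rewrite !derive1E deriveM.
Qed.

Lemma Cn_cst n (c : R) : Cn n (cst c).
Proof.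
elim: n c => [c|n IH c]; first by split=> // x; exact: cvg_cst.
apply/CnS; split=> [x|]; first exact: derivable_cst.
by rewrite (_ : (_)^`()%classic = cst 0)//; apply/funext => x; rewrite derive1_cst.
Qed.

Lemma is_derive_affine (c d x : R) : is_derive x 1 (fun y => c * y + d) c.
Proof.
have H : is_derive x 1 ((c *: (id : R -> R)) + cst d) (c *: (1 : R) + 0).
  by apply: is_deriveD.
by rewrite (_ : _ + 0 = c) in H; last by rewrite addr0 -[LHS]/(c * 1) mulr1.
Qed.

Lemma is_derive_comp_affine (c d : R) f x : derivable f (c * x + d) 1 ->
  is_derive x 1 (fun y => f (c * y + d)) (c * (f^`())%classic (c * x + d)).
Proof.
move=> df; rewrite derive1E mulrC.
by apply: (@is_derive1_comp _ f (fun y => c * y + d));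
   [exact: derivableP|exact: is_derive_affine].
Qed.

Lemma Cn_comp_affine n (c d : R) f : Cn n f -> Cn n (fun x => f (c * x + d)).
Proof.
elim: n f => [f [_ cf]|n IH f /CnS[df cf]].
  split=> // x; apply: (@continuous_comp _ _ _ (fun y => c * y + d) f);
    last exact: cf.
  by apply: differentiable_continuous; apply/derivable1_diffP;
     have [] := is_derive_affine c d x.
have D x := is_derive_comp_affine (df (c * x + d)).
apply/CnS; split=> [x|]; first by have [] := D x.
suff -> : ((fun x => f (c * x + d))^`() =
    cst c \* (fun x => (f^`()) (c * x + d)))%classic.
  by apply: CnM; [exact: Cn_cst|exact: IH].
by apply/funext => x; rewrite derive1E; have [_ ->] := D x.
Qed.

(** One term of the exponential series gives [y^i <= i! e^y] for [y >= 0]; summing over the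
    coefficients produces the constant. *)
Lemma poly_le_expR (p : {poly R}) :
  exists2 C, 0 <= C & forall y, 0 <= y -> `|p.[y]| <= C * expR y.
Proof.
exists (\sum_(i < size p) `|p`_i| * i`!%:R).
  by apply: sumr_ge0 => i _; rewrite mulr_ge0.
move=> y y0; rewrite horner_coef (le_trans (ler_norm_sum _ _ _))// mulr_suml.
apply: ler_sum => i _; rewrite normrM -mulrA ler_wpM2l// ger0_norm ?exprn_ge0//.
case: (nat_of_ord i) => [|k].
  by rewrite expr0 fact0 mul1r -[leLHS]expR0 ler_expR.
rewrite mulrC -ler_pdivrMr ?ltr0n ?fact_gt0//.
by apply: le_trans (expR_ge1Dxn k y0); rewrite lerDr.
Qed.

(** For [p = 1] this is the classical smooth function [e^(-1/x)], flat at 0. The polynomial factor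
    makes the family stable under differentiation, so that smoothness of all its members follows by
    one induction. *)
Definition flat (p : {poly R}) (x : R) : R :=
  if 0 < x then p.[x^-1] * expR (- x^-1) else 0.

(* From d/dx (p(1/x) e^(-1/x)) = ((p - p')(1/x) / x^2) e^(-1/x). *)
Definition flat_deriv (p : {poly R}) : {poly R} := 'X^2 * (p - p^`()).

Lemma flat_le0 p x : x <= 0 -> flat p x = 0.
Proof. by rewrite /flat ltNge => ->. Qed.

Lemma flat_gt0 p x : 0 < x -> flat p x = p.[x^-1] * expR (- x^-1).
Proof. by rewrite /flat => ->. Qed.

(** Apply the exponential bound to [X^2 p] at [1/x]. Quadratic decay is what makes the difference
    quotient at 0 tend to 0. *)
Lemma flat_le_sqr (p : {poly R}) : exists2 C, 0 <= C & forall x, `|flat p x| <= C * x ^+ 2.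
Proof.
have [C C0 pC] := poly_le_expR ('X^2 * p); exists C => // x.
rewrite /flat; case: ifPn => [x0|_]; last by rewrite normr0 mulr_ge0 ?sqr_ge0.
have xV0 : 0 <= x^-1 by rewrite invr_ge0 ltW.
have := pC _ xV0.
rewrite hornerM hornerXn normrM (ger0_norm (exprn_ge0 _ xV0)) exprVn mulrC.
rewrite ler_pdivrMr ?exprn_gt0// normrM (ger0_norm (expR_ge0 _)).
rewrite expRN -mulrA (mulrC (expR _)) mulrA => H.
by rewrite ler_pdivrMr ?expR_gt0.
Qed.

Lemma is_derive_flat (p : {poly R}) (x : R) : is_derive x 1 (flat p) (flat (flat_deriv p) x).
Proof.
have [x0|x0|->] := ltgtP x 0.
- rewrite (flat_le0 _ (ltW x0)).
  apply: near_eq_is_derive (is_derive_cst 0 x 1).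
  by near=> y; rewrite flat_le0//; apply/ltW; near: y; exact: lt_nbhsl.
- have xn0 : x != 0 by rewrite gt_eqF.
  rewrite (flat_gt0 _ x0).
  have dV : is_derive x 1 (fun y => y^-1) (- (x^-1 ^+ 2)).
    have := @is_deriveV _ id x 1 1 xn0 (is_derive_id x 1).
    by rewrite exprVn -[_ *: 1]/(_ * 1) mulr1.
  have dp := @is_derive1_comp _ (horner p) (fun y => y^-1) x _ _
    (is_derive_poly p x^-1) dV.
  have dE := @is_derive1_comp _ expR (fun y => - y^-1) x _ _
    (is_derive_expR (- x^-1)) (is_deriveN dV).
  apply: (@near_eq_is_derive _ _ _ ((horner p \o (fun y => y^-1)) *
    (expR \o (fun y => - y^-1)))).
    by near=> y; rewrite flat_gt0//; near: y; exact: lt_nbhsr.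
  apply: is_derive_eq (is_deriveM dp dE) _.
  rewrite /flat_deriv hornerM hornerXn hornerD hornerN /GRing.scale/=; ring.
- rewrite (flat_le0 _ (lexx 0)); apply/is_derive1_caratheodory.
  have [C C0 pC] := flat_le_sqr p.
  (* The Caratheodory slope at 0: bounded by [C |y|], hence continuous there, with value 0 at
     [y = 0] since the inverse of 0 is 0. *)
  exists (fun y => flat p y / y); split.
  + move=> z; rewrite (flat_le0 p (lexx 0)) !subr0; have [->|z0] := eqVneq z 0.
      by rewrite mulr0 flat_le0 ?lexx.
    by rewrite divfK.
  + rewrite /prop_for /continuous_at invr0 mulr0; apply/cvgr0Pnorm_le => /= e e0.
    near=> y; rewrite normrM normfV; have [->|y0] := eqVneq y 0.
      by rewrite normr0 invr0 mulr0 ltW.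
    rewrite ler_pdivrMr ?normr_gt0// (le_trans (pC y))//.
    rewrite -(real_normK (num_real y)) expr2 mulrA ler_wpM2r//.
    have : `|y| <= e / (C + 1).
      near: y; apply: cvgr0_norm_le; last by rewrite divr_gt0// ltr_wpDl.
      exact: cvg_id.
    rewrite ler_pdivlMr ?ltr_wpDl// => H; apply: le_trans H.
    by rewrite mulrC ler_wpM2l// lerDl.
  + by rewrite invr0 mulr0.
Unshelve. all: by end_near. Qed.

Lemma Cn_flat n (p : {poly R}) : Cn n (flat p).
Proof.
elim: n p => [p|n IH p].
  split=> // x; apply: differentiable_continuous; apply/derivable1_diffP.
  by have [] := is_derive_flat p x.
apply/CnS; split=> [x|]; first by have [] := is_derive_flat p x.
suff -> : ((flat p)^`())%classic = flat (flat_deriv p) by exact: IH.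
by apply/funext => x; rewrite derive1E; have [_ ->] := is_derive_flat p x.
Qed.

Lemma flat1_ge0 x : 0 <= flat 1 x.
Proof. by rewrite /flat; case: ifPn => // _; rewrite hornerC mul1r expR_ge0. Qed.

Lemma flat1_le1 x : flat 1 x <= 1.
Proof.
rewrite /flat; case: ifPn => // x0.
by rewrite hornerC mul1r expR_le1 oppr_le0 invr_ge0 ltW.
Qed.

(** The factor [n.+1] steepens both flanks: the bumps stay between 0 and 1 and tend pointwise to the
    indicator of the open interval, as dominated convergence requires. For [b <= a] they vanish
    identically. *)
Definition bump (a b : R) (n : nat) (x : R) : R :=
  flat 1 (n.+1%:R * (x - a)) * flat 1 (n.+1%:R * (b - x)).

Lemma bump_ge0 a b n x : 0 <= bump a b n x.
Proof. by rewrite mulr_ge0// flat1_ge0. Qed.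

Lemma bump_le1 a b n x : bump a b n x <= 1.
Proof. by rewrite mulr_ile1// ?flat1_ge0 ?flat1_le1. Qed.

Lemma bump_eq0 a b n x : x \notin `]a, b[ -> bump a b n x = 0.
Proof.
rewrite in_itv/= negb_and -!leNgt /bump {1 2}/flat => /orP[xa|bx].
  by rewrite ifN ?mul0r// -leNgt pmulr_rle0// subr_le0.
by rewrite [X in _ * X]ifN ?mulr0// -leNgt pmulr_rle0// subr_le0.
Qed.

Lemma Cn_bump a b m n : Cn m (bump a b n).
Proof.
have -> : bump a b n = (fun x => flat 1 (n.+1%:R * x + - (n.+1%:R * a))) \*
    (fun x => flat 1 (- n.+1%:R * x + n.+1%:R * b)).
  by apply/funext => x /=; congr (flat 1 _ * flat 1 _); ring.
by apply: CnM; apply: Cn_comp_affine; exact: Cn_flat.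
Qed.

Lemma test_function_itv (f : R -> R) a b : (forall n, Cn n f) ->
  (forall x, x \notin `[a, b] -> f x = 0) -> test_function f.
Proof.
move=> Cf f0; split=> //; exists `[a, b]%classic; first exact: segment_compact.
by move=> x /= /negP; exact: f0.
Qed.

Lemma test_bump a b n : test_function (bump a b n).
Proof.
apply: (@test_function_itv _ a b) => [m|x xab]; first exact: Cn_bump.
by apply: bump_eq0; apply: contra xab; exact: subset_itv_oo_cc.
Qed.

Lemma cvg_flat1 x : 0 < x -> flat 1 (n.+1%:R * x) @[n --> \oo] --> (1 : R).
Proof.
move=> x0; rewrite (_ : (fun n => _) = fun n => expR (- (n.+1%:R^-1 / x))).
  rewrite -[X in _ --> X]expR0; apply: continuous_cvg; first exact: continuous_expR.
  rewrite -[X in _ --> X]oppr0; apply: cvgN; rewrite -(mul0r x^-1).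
  by apply: cvgMl; exact: cvg_harmonic.
apply/funext => n; rewrite /flat ifT; last by rewrite mulr_gt0.
by rewrite hornerC mul1r invfM.
Qed.

Lemma cvg_bump a b x :
  bump a b n x @[n --> \oo] --> (\1_(`]a, b[%classic) x : R).
Proof.
rewrite indicE mem_setE; have [|xab] := boolP (x \in `]a, b[); last first.
  rewrite (_ : (fun n => _) = cst 0); first exact: cvg_cst.
  by apply/funext => n; rewrite bump_eq0.
rewrite in_itv/= => /andP[ax xb].
by rewrite -[1%:R]mulr1; apply: cvgM; apply: cvg_flat1; rewrite subr_gt0.
Qed.

End smooth_functions.

(** * Primitives of integrable functions *)

Section primitives.
Context {R : realType}.
Local Notation leb := (@lebesgue_measure R).
Implicit Types (a b c x : R) (f g v w F G : R -> R).

Lemma integrable_subitv v a b c d : a <= c -> d <= b ->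
  leb.-integrable `[a, b] (EFin \o v) -> leb.-integrable `[c, d] (EFin \o v).
Proof.
move=> ac db; apply: integrableS => //.
by apply: subset_itv; rewrite bnd_simp.
Qed.

Lemma integrable_scale d (T : measurableType d) (m : {measure set T -> \bar R})
    (D : set T) c (f : T -> R) : measurable D ->
  m.-integrable D (EFin \o f) -> m.-integrable D (EFin \o (fun t => c * f t)).
Proof.
move=> mD /(integrableZl mD c).
by apply: eq_integrable => // t _; rewrite /= EFinM.
Qed.

Lemma integrable_add d (T : measurableType d) (m : {measure set T -> \bar R})
    (D : set T) (f g : T -> R) : measurable D ->
  m.-integrable D (EFin \o f) -> m.-integrable D (EFin \o g) ->
  m.-integrable D (EFin \o (fun t => f t + g t)).
Proof.
move=> mD mf /(integrableD mD mf).
by apply: eq_integrable => // t _; rewrite /= EFinD.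
Qed.

Lemma integrable_patch (D : set (measurableTypeR R)) f : measurable D ->
  leb.-integrable D (EFin \o f) <-> leb.-integrable setT (EFin \o (f \_ D)).
Proof. by move=> mD; rewrite -restrict_EFin; exact: integrable_mkcond. Qed.

(** Fubini for [v(y) w(x)] on the triangle [y <= x] of the square. Both functions are merely
    integrable, so classical integration by parts for C^1 functions does not apply. *)
Lemma Rintegral_by_parts_prim v w a b :
  leb.-integrable `[a, b] (EFin \o v) -> leb.-integrable `[a, b] (EFin \o w) ->
  leb.-integrable `[a, b]
    (EFin \o (fun x => w x * \int[leb]_(y in `[a, x]) v y)) /\
  \int[leb]_(x in `[a, b]) (w x * \int[leb]_(y in `[a, x]) v y) =
  \int[leb]_(y in `[a, b]) (v y * \int[leb]_(x in `[y, b]) w x).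
Proof.
move=> iv iw.
pose v' := v \_ `[a, b]; pose w' := w \_ `[a, b].
have iv' : leb.-integrable setT (EFin \o v').
  exact: (@integrable_patch `[a, b]%classic v (measurable_itv _)).1.
have iw' : leb.-integrable setT (EFin \o w').
  exact: (@integrable_patch `[a, b]%classic w (measurable_itv _)).1.
have mv' : measurable_fun setT v' by apply/measurable_EFinP; case/integrableP: iv'.
have mw' : measurable_fun setT w' by apply/measurable_EFinP; case/integrableP: iw'.
pose A := [set z : measurableTypeR R * measurableTypeR R | z.2 <= z.1].
have mA : measurable A.
  by rewrite -[A]setTI; exact: measurable_fun_le.
(* The extensions by zero carry the square and the indicator carries the triangle; [|k|] is at most
   the product of two integrable functions. Integrating first in [y] gives [K1], first in [x] gives
   [K2]. *)
pose k (z : measurableTypeR R * measurableTypeR R) : R := v' z.2 * w' z.1 * \1_A z.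
have kE x y : k (x, y) = v' y * w' x * (y <= x)%R%:R.
  by rewrite /k indicE; congr (_ * (nat_of_bool _)%:R); apply/idP/idP; rewrite inE.
have mk : measurable_fun setT k.
  apply: measurable_funM; last exact: measurable_indic.
  by apply: measurable_funM; apply: measurableT_comp.
have ik : (leb \x leb)%E.-integrable setT (EFin \o k).
  apply/integrable12ltyP; first exact/measurable_EFinP.
  apply: (@le_lt_trans _ _ (\int[leb]_x (`|w' x|%:E * \int[leb]_y `|v' y|%:E))%E).
    apply: ge0_le_integral => //.
    - by move=> x _; exact: integral_ge0.
    - apply: (measurable_fun_fubini_tonelli_F (fun z => `|(k z)%:E|%E)) => //.
      by apply: measurableT_comp => //; exact/measurable_EFinP.
    - apply: emeasurable_funM; last exact: measurable_cst.
      by apply/measurable_EFinP; exact: measurableT_comp.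
    - move=> x _; rewrite -ge0_integralZl//; last first.
        by apply/measurable_EFinP; exact: measurableT_comp.
      apply: ge0_le_integral => //.
      + apply: measurableT_comp => //; apply/measurable_EFinP.
        exact: (measurableT_comp mk).
      + apply/measurable_EFinP; apply: measurable_funM; first exact: measurable_cst.
        exact: measurableT_comp.
      + move=> y _; rewrite /k /= -EFinM lee_fin !normrM mulrAC.
        rewrite [leLHS]mulrC mulrA ler_piMr ?mulr_ge0//.
        by rewrite indicE; case: (_ \in _); rewrite ?normr1 ?normr0.
  have [_ v'oo] := integrableP _ _ _ iv'; have [_ w'oo] := integrableP _ _ _ iw'.
  rewrite ge0_integralZr//; last 2 first.
    by apply/measurable_EFinP; exact: measurableT_comp.
    exact: integral_ge0.
  by rewrite lte_mul_pinfty// ?integral_ge0// ge0_fin_numE// integral_ge0.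
pose K1 := (fun x => w x * \int[leb]_(y in `[a, x]) v y) \_ `[a, b].
have E1 x : (\int[leb]_y (k (x, y))%:E = (K1 x)%:E)%E.
  rewrite /K1 patchE; case: ifPn => xab; last first.
    rewrite integral0_eq// => y _.
    by rewrite /k /w' /= patchE (negbTE xab) mulr0 mul0r.
  have /andP[ax xb] : a <= x <= b by move: xab; rewrite inE /= in_itv.
  have ivx := integrable_subitv (lexx a) xb iv.
  rewrite -RintegralZl// [RHS]fineK ?integrable_fin_num//; last first.
    exact: (integrable_scale _ _ ivx).
  rewrite [RHS]integral_mkcond; apply: eq_integral => y _.
  rewrite kE /w' /v' /= !patchE xab !mem_setE.
  rewrite !in_itv/=; have [ay|_] := leP a y => /=; last first.
    by rewrite !mul0r.
  have [yx|xy] := leP y x; last by rewrite mulr0.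
  by rewrite (le_trans yx xb) mulr1 mulrC.
pose K2 := (fun y => v y * \int[leb]_(x in `[y, b]) w x) \_ `[a, b].
have E2 y : (\int[leb]_x (k (x, y))%:E = (K2 y)%:E)%E.
  rewrite /K2 patchE; case: ifPn => yab; last first.
    rewrite integral0_eq// => x _.
    by rewrite /k /v' /= patchE (negbTE yab) !mul0r.
  have /andP[ay yb] : a <= y <= b by move: yab; rewrite inE /= in_itv.
  have iwy := integrable_subitv ay (lexx b) iw.
  rewrite -RintegralZl// [RHS]fineK ?integrable_fin_num//; last first.
    exact: (integrable_scale _ _ iwy).
  rewrite [RHS]integral_mkcond; apply: eq_integral => x _.
  rewrite kE /w' /v' /= !patchE yab !mem_setE.
  rewrite !in_itv/=; have [yx|xy] := leP y x => /=; last by rewrite mulr0.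
  rewrite (le_trans ay yx) mulr1/=.
  by case: (x <= b); rewrite ?mulr0.
have FE : fubini_F leb (EFin \o k) = EFin \o K1 by apply/funext.
have GE : fubini_G leb (EFin \o k) = EFin \o K2 by apply/funext.
split.
  have := integrable_fubini_F ik; rewrite FE => iK1.
  exact/integrable_patch.
rewrite Rintegral_mkcond [RHS]Rintegral_mkcond /Rintegral; apply: (congr1 fine).
transitivity (\int[leb]_x \int[leb]_y (k (x, y))%:E)%E.
  by apply: eq_integral => x _; rewrite E1.
rewrite (Fubini ik); apply: eq_integral => y _; exact: E2.
Qed.


(** After the exchange of order, the first summand integrates [v(y)] against the integral of [w]
    over [[y, b]], that is, the full integral minus the one over [[a, y]]; the latter cancels the
    second summand. *)
Lemma Rintegral_prim_mul v w a b : a <= b ->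
  leb.-integrable `[a, b] (EFin \o v) -> leb.-integrable `[a, b] (EFin \o w) ->
  \int[leb]_(x in `[a, b]) (w x * \int[leb]_(y in `[a, x]) v y) +
  \int[leb]_(x in `[a, b]) (v x * \int[leb]_(y in `[a, x]) w y) =
  (\int[leb]_(x in `[a, b]) v x) * \int[leb]_(x in `[a, b]) w x.
Proof.
move=> ab iv iw; have [ivw ->] := Rintegral_by_parts_prim iv iw.
have [iwv _] := Rintegral_by_parts_prim iw iv.
rewrite [X in X + _](_ : _ = \int[leb]_(y in `[a, b])
    ((\int[leb]_(x in `[a, b]) w x) * v y -
     v y * \int[leb]_(x in `[a, y]) w x)); last first.
  apply: eq_Rintegral => y; rewrite inE/= in_itv/= => /andP[ay yb].
  rewrite [X in X - _]mulrC -mulrBr; congr (_ * _).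
  rewrite Rintegral_itvB ?bnd_simp// Rintegral_itv_obnd_cbnd//.
  apply: integrableS iw => //.
  by apply: subset_itv; rewrite bnd_simp.
rewrite RintegralB//; last exact: integrable_scale.
by rewrite addrNK RintegralZl// mulrC.
Qed.

(** Absolute continuity of [F] on [[a, b]] with derivative [v], in integral form, so that no
    pointwise derivative has to be handled. *)
Definition primitive_on a b F v : Prop :=
  leb.-integrable `[a, b] (EFin \o v) /\
  forall x, x \in `[a, b] -> F x = F a + \int[leb]_(y in `[a, x]) v y.

Lemma primitive_onE a b F v x : primitive_on a b F v -> x \in `[a, b] ->
  F x - F a = \int[leb]_(y in `[a, x]) v y.
Proof. by move=> [_ Fv] xab; rewrite Fv// addrC addKr. Qed.

Lemma integrable_mul_primitive a b F v w : primitive_on a b F v ->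
  leb.-integrable `[a, b] (EFin \o w) ->
  leb.-integrable `[a, b] (EFin \o (fun x => w x * F x)).
Proof.
move=> [iv Fv] iw; have [iwV _] := Rintegral_by_parts_prim iv iw.
have : leb.-integrable `[a, b] (EFin \o (fun x => F a * w x +
    w x * \int[leb]_(y in `[a, x]) v y)).
  by apply: integrable_add => //; exact: integrable_scale.
apply: eq_integrable => // x; rewrite inE/= => xab.
by rewrite (Fv x xab) mulrDr (mulrC (F a)).
Qed.

(** The product rule for absolutely continuous functions. Writing each factor as its value at [a]
    plus an integral, the two double integrals add up to [(F x - F a) (G x - G a)]. *)
Lemma primitive_onM a b F v G w :
  primitive_on a b F v -> primitive_on a b G w ->
  primitive_on a b (F \* G) (fun x => w x * F x + v x * G x).
Proof.
move=> pF pG; have [iv Fv] := pF; have [iw Gw] := pG.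
have iwF := integrable_mul_primitive pF iw.
have ivG := integrable_mul_primitive pG iv.
split=> [|x xab]; first exact: integrable_add.
have /andP[ax xb] : a <= x <= b by move: xab; rewrite in_itv.
have ivx := integrable_subitv (lexx a) xb iv.
have iwx := integrable_subitv (lexx a) xb iw.
rewrite RintegralD//; last 2 first.
  exact: integrable_subitv iwF.
  exact: integrable_subitv ivG.
have E u H K : primitive_on a b H u ->
    leb.-integrable `[a, x] (EFin \o u) ->
    leb.-integrable `[a, x] (EFin \o K) ->
    \int[leb]_(y in `[a, x]) (K y * H y) =
    H a * (\int[leb]_(y in `[a, x]) K y) +
    \int[leb]_(y in `[a, x]) (K y * \int[leb]_(z in `[a, y]) u z).
  move=> [_ Hu] iu iK; rewrite -RintegralZl// -RintegralD//; last 2 first.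
    exact: integrable_scale.
    by have [] := Rintegral_by_parts_prim iu iK.
  apply: eq_Rintegral => y; rewrite inE/= in_itv/= => /andP[ay yx].
  by rewrite Hu ?in_itv/= ?ay ?(le_trans yx)//; ring.
rewrite (E _ _ _ pF ivx iwx) (E _ _ _ pG iwx ivx).
have := Rintegral_prim_mul ax ivx iwx.
rewrite -(primitive_onE pF xab) -(primitive_onE pG xab) /= => H.
rewrite addrACA H; ring.
Qed.

Lemma integrable_continuous_itv f a b : continuous f ->
  leb.-integrable `[a, b] (EFin \o f).
Proof.
move=> cf; apply: continuous_compact_integrable; first exact: segment_compact.
exact: continuous_subspaceT.
Qed.

Lemma primitive_on_Cn1 f a b : Cn 1 f -> primitive_on a b f (f^`())%classic.
Proof.
move=> Cf; have [df [_ cdf]] := (CnS _ _).1 Cf; have cf := Cn_continuous Cf.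
split=> [|x]; first exact: integrable_continuous_itv.
rewrite in_itv/= => /andP[]; rewrite le_eqVlt => /predU1P[<- _|ax xb].
  by rewrite set_itv1 Rintegral_set1 addr0.
have dfx : derivable_oo_LRcontinuous f a x.
  split=> [y _||]; first exact: df.
    by apply: cvg_at_right_filter; exact: cf.
  by apply: cvg_at_left_filter; exact: cf.
have := @continuous_FTC2 _ (f^`())%classic f a x ax
  (continuous_subspaceT cdf) dfx (fun _ _ => erefl).
by rewrite /Rintegral => ->; rewrite /= [RHS]addrC subrK.
Qed.

(** The open interval forces [f] to vanish at both endpoints, which removes the boundary terms. *)
Definition supported f a b : Prop := forall x, x \notin `]a, b[ -> f x = 0.

Lemma supported_deriv f a b : supported f a b ->
  forall x, x \notin `[a, b] -> (f^`())%classic x = 0.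
Proof.
move=> f0 x; rewrite in_itv/= negb_and -!ltNge => xab.
rewrite derive1E (@near_eq_derive _ _ _ f (cst 0)) ?derive_cst//.
case/orP: xab => [xa|bx]; near=> y; apply: f0; rewrite in_itv/= negb_and -!leNgt.
  by apply/orP; left; apply/ltW; near: y; exact: lt_nbhsl.
by apply/orP; right; apply/ltW; near: y; exact: lt_nbhsr.
Unshelve. all: by end_near. Qed.

Lemma Rintegral_supported f g a b : (forall x, x \notin `[a, b] -> g x = 0) ->
  \int[leb]_x (f x * g x) = \int[leb]_(x in `[a, b]) (f x * g x).
Proof.
move=> g0; rewrite [RHS]Rintegral_mkcond; apply: eq_Rintegral => x _.
by rewrite patchE mem_setE; case: ifPn => // /g0 ->; rewrite mulr0.
Qed.

Lemma integrable_continuousM f g a b : leb.-integrable `[a, b] (EFin \o f) ->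
  continuous g -> leb.-integrable `[a, b] (EFin \o (fun x => f x * g x)).
Proof.
move=> fi cg; have mg : measurable_fun `[a, b] g.
  by apply: measurable_funS (continuous_measurable_fun cg).
have [M [_ Mg]] : [bounded g x | x in `[a, b]].
  have /compact_bounded[M [Mr Mg]] :
      compact (g @` `[a, b]%classic).
    by apply: continuous_compact; [exact: continuous_subspaceT|exact: segment_compact].
  by exists M; split=> // N MN x xab; apply: Mg => //; exists x.
apply: (integrableMl _ fi mg) => //.
by exists M; split; rewrite ?num_real.
Qed.

End primitives.

(** * Weak derivatives of real functions *)

Section weak_derivatives_of_real_functions.
Context {R : realType}.
Local Notation leb := (@lebesgue_measure R).
Implicit Types (a b c d x : R) (f g u v F G : R -> R).

Lemma ae_lebesgueS (P Q : R -> Prop) : (forall x, P x -> Q x) ->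
  {ae leb, forall x, P x} -> {ae leb, forall x, Q x}.
Proof.
by move=> PQ; apply: (@filterS _ _ (ae_filter_ringOfSetsType leb) P Q PQ).
Qed.

Lemma ae_lebesgueI (P Q : R -> Prop) : {ae leb, forall x, P x} ->
  {ae leb, forall x, Q x} -> {ae leb, forall x, P x /\ Q x}.
Proof.
move=> aP aQ; exact: (@filterI _ _ (ae_filter_ringOfSetsType leb) P Q aP aQ).
Qed.

Lemma cvg_integral_bump g a b c d : leb.-integrable `[a, b] (EFin \o g) ->
  \int[leb]_(x in `[a, b]) (g x * bump c d n x) @[n --> \oo] -->
  \int[leb]_(x in `[a, b]) (g x * \1_(`]c, d[%classic) x).
Proof.
move=> ig; have mg : measurable_fun (`[a, b]%classic : set (measurableTypeR R)) g.
  by apply/measurable_EFinP; case/integrableP: ig.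
have mbump n :
    measurable_fun (`[a, b]%classic : set (measurableTypeR R)) (bump c d n).
  apply: measurable_funTS; apply: continuous_measurable_fun.
  exact: (Cn_continuous (Cn_bump c d 0 n)).
have [iG _ cvg] : [/\ leb.-integrable `[a, b]
      (EFin \o (fun x => g x * \1_(`]c, d[%classic) x)),
    [sequence \int[leb]_(x in `[a, b])
      `|(g x * bump c d n x)%:E - (g x * \1_(`]c, d[%classic) x)%:E|]_n%E
      @ \oo --> 0%E &
    [sequence \int[leb]_(x in `[a, b]) (g x * bump c d n x)%:E]_n%E @ \oo -->
    (\int[leb]_(x in `[a, b]) (g x * \1_(`]c, d[%classic) x)%:E)%E].
  apply: (@dominated_convergence _ _ _ leb `[a, b]%classic _
      (fun n x => (g x * bump c d n x)%:E) _ (fun x => `|g x|%:E)) => //.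
  - by move=> n; apply/measurable_EFinP; exact: measurable_funM.
  - by apply/measurable_EFinP; exact: measurable_funM.
  - apply: aeW => x _; apply: cvg_EFin; first exact: nearW.
    by apply: cvgM; [exact: cvg_cst|exact: cvg_bump].
  - exact: integrable_norm.
  - apply: aeW => x n _ /=; rewrite lee_fin normrM ler_piMr//.
    by rewrite ger0_norm ?bump_ge0// bump_le1.
apply: fine_cvg; rewrite fineK ?integrable_fin_num//.
Qed.

(** The integrals tend to [b - a], so they cannot all be zero. *)
Lemma bump_integral_neq0 a b : a < b ->
  exists n, \int[leb]_(x in `[a, b]) bump a b n x != 0.
Proof.
move=> ab; apply/not_existsP => H.
have i1 : leb.-integrable `[a, b] (EFin \o cst 1).
  by apply: integrable_continuous_itv => x; exact: cvg_cst.
have := cvg_integral_bump (c := a) (d := b) i1.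
rewrite (_ : (fun n => _) = cst 0); last first.
  apply/funext => n /=; under eq_Rintegral do rewrite mul1r.
  by apply/eqP/negPn/negP/H.
move=> /(cvg_lim (@Rhausdorff R)); rewrite lim_cst; last exact: Rhausdorff.
under eq_Rintegral do rewrite mul1r.
have -> : \int[leb]_(x in `[a, b]) \1_(`]a, b[%classic) x = b - a.
  rewrite /Rintegral integral_indic//= setIidl; last exact: subset_itv_oo_cc.
  by rewrite lebesgue_measure_itv/= lte_fin ab.
by move/eqP; rewrite eq_sym subr_eq0 gt_eqF.
Qed.

(** Bumps on []a, d[] show in the limit that the integral of [g] over [[a, d]] is zero for every
    [d <= b]. By Lebesgue differentiation [g] is almost everywhere the derivative of this vanishing
    primitive. *)
Lemma fundamental_lemma g a b : leb.-integrable `[a, b] (EFin \o g) ->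
  (forall phi, test_function phi -> supported phi a b ->
    \int[leb]_(x in `[a, b]) (g x * phi x) = 0) ->
  {ae leb, forall x, x \in `]a, b[ -> g x = 0}.
Proof.
move=> ig g0.
have int0 d : d <= b -> \int[leb]_(x in `[a, d]) g x = 0.
  move=> db; have := cvg_integral_bump (c := a) (d := d) ig.
  rewrite (_ : (fun n => _) = cst 0); last first.
    apply/funext => n; apply: g0; first exact: test_bump.
    move=> x xab; apply: bump_eq0; apply: contra xab.
    by apply: subset_itv; rewrite bnd_simp.
  move=> /(cvg_lim (@Rhausdorff R)); rewrite lim_cst; last exact: Rhausdorff.
  move=> ->; rewrite -Rintegral_itv_bndo_bndc; last first.
    apply: integrableS ig => //; apply: subset_itv; rewrite bnd_simp//.
  have [da|ad] := leP d a.
    rewrite !(@set_itv_ge _ _ _ (BLeft d)) ?bnd_simp -?leNgt// Rintegral_set0.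
    under [in RHS]eq_Rintegral do rewrite indic0 mulr0.
    by rewrite Rintegral_cst// mul0r.
  rewrite -Rintegral_itv_obnd_cbnd; last first.
    apply: integrableS ig => //; apply: subset_itv; rewrite bnd_simp//.
  rewrite [LHS]Rintegral_mkcond [RHS]Rintegral_mkcond; apply: eq_Rintegral => x _.
  rewrite !patchE indicE !mem_setE; case: ifPn => xad.
    by rewrite (subset_itv_oo_cc _) ?mulr1//; apply: subset_itv xad; rewrite bnd_simp.
  by case: ifPn => // _; rewrite mulr0.
pose f := g \_ `[a, b].
have lf : locally_integrable setT f by exact: integrable_locally_restrict.
have fi y : leb.-integrable `[a, y] (EFin \o f).
  apply: (@integrableS _ _ _ _ setT) => //.
  exact: (@integrable_patch _ `[a, b]%classic g (measurable_itv _)).1.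
have := FTC1 fi lf; apply: ae_lebesgueS => x Hx /[dup] xab.
rewrite in_itv/= => /andP[ax xb].
have {Hx}[|_] := Hx; first by rewrite lte_fin.
rewrite /f patchE mem_setE (subset_itv_oo_cc xab) => <-.
rewrite derive1E (@near_eq_derive _ _ _ _ (cst 0)) ?derive_cst//.
near=> y; have yb : y <= b by apply/ltW; near: y; exact: lt_nbhsl.
rewrite /= -[RHS](int0 y yb); apply: eq_Rintegral => z; rewrite inE/= in_itv/= => /andP[az zy].
by rewrite /f patchE mem_setE in_itv/= az (le_trans zy).
Unshelve. all: by end_near. Qed.

(** A test function of integral zero is the derivative of a test function. Any [phi] becomes one
    after subtracting the multiple of a fixed bump [theta] with the same integral, and the
    hypothesis then says that [u - c] is orthogonal to [phi], where [c] is the mean of [u] weighted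
    by [theta]. *)
Lemma du_Bois_Reymond u a b : a < b -> leb.-integrable `[a, b] (EFin \o u) ->
  (forall phi, test_function phi -> supported phi a b ->
    \int[leb]_(x in `[a, b]) (u x * (phi^`())%classic x) = 0) ->
  exists c, {ae leb, forall x, x \in `]a, b[ -> u x = c}.
Proof.
move=> ab iu u0; have [n I0] := bump_integral_neq0 ab.
pose theta := bump a b n; pose I := \int[leb]_(x in `[a, b]) theta x.
have Ctheta m : Cn m theta by exact: Cn_bump.
have cont_int f : continuous f -> leb.-integrable `[a, b] (EFin \o f).
  exact: integrable_continuous_itv.
pose c := \int[leb]_(x in `[a, b]) (u x * theta x) / I.
exists c.
have iuc : leb.-integrable `[a, b] (EFin \o (fun x => u x + - c)).
  by apply: integrable_add => //; apply: cont_int => x; exact: cvg_cst.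
suff : {ae leb, forall x, x \in `]a, b[ -> u x + - c = 0}.
  by apply: ae_lebesgueS => x H /H /eqP; rewrite subr_eq0 => /eqP.
apply: fundamental_lemma => // phi [Cphi _] sphi.
have cphi := Cn_continuous (Cphi 0); have ctheta := Cn_continuous (Ctheta 0).
pose k := \int[leb]_(x in `[a, b]) phi x / I.
pose rho x := phi x + - k * theta x.
have Crho m : Cn m rho.
  by apply: CnD => //; apply: (@CnM _ _ (cst (- k))) => //; exact: Cn_cst.
have crho := Cn_continuous (Crho 0).
have srho : supported rho a b.
  by move=> x xab; rewrite /rho sphi// /theta bump_eq0// mulr0 addr0.
have rho0 : \int[leb]_(x in `[a, b]) rho x = 0.
  rewrite RintegralD//; [|exact: cont_int|]; last first.
    by apply: integrable_scale => //; exact: cont_int.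
  rewrite RintegralZl//; last exact: cont_int.
  by rewrite -/I mulNr divfK// subrr.
have irho : leb.-integrable setT (EFin \o rho).
  have -> : rho = rho \_ `[a, b].
    apply/funext => x; rewrite patchE mem_setE; case: ifPn => // xab.
    by rewrite srho//; apply: contra xab; exact: subset_itv_oo_cc.
  by apply: (@integrable_patch _ `[a, b]%classic rho (measurable_itv _)).1; exact: cont_int.
(* Starting at minus infinity gives one formula differentiable at every point. [Phi] vanishes to the
   left of [a] because [rho] does, and to the right of [b] because [rho] has integral zero. *)
pose Phi x := \int[leb]_(t in `]-oo, x]) rho t.
have dPhi x : derivable Phi x 1 /\ (Phi^`())%classic x = rho x.
  apply: (@continuous_FTC1 _ rho -oo%O x (x + 1)); rewrite ?ltrDl//.
  - exact: integrableS irho.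
  - exact: ltNyr.
  - exact: crho.
have Phi' : (Phi^`())%classic = rho by apply/funext => y; have [] := dPhi y.
have CPhi m : Cn m Phi.
  by apply: CnW; apply/CnS; split=> [x|]; [have [] := dPhi x|rewrite Phi'].
have sPhi : supported Phi a b.
  move=> x; rewrite in_itv/= negb_and -!leNgt => xab.
  have [xa|ax] := leP x a.
    rewrite /Phi; under eq_Rintegral => t.
      rewrite inE/= in_itv/= => tx.
      rewrite srho; last by rewrite in_itv/= negb_and -leNgt (le_trans tx).
      over.
    by rewrite Rintegral_cst// mul0r.
  have bx : b <= x by move: xab; rewrite leNgt ax.
  rewrite -rho0 /Phi [LHS]Rintegral_mkcond [RHS]Rintegral_mkcond.
  apply: eq_Rintegral => t _; rewrite !patchE !mem_setE !in_itv/=.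
  have [ta|at_] := leP t a => /=.
    rewrite srho; last by rewrite in_itv/= negb_and -leNgt ta.
    by do 2 case: ifP.
  rewrite (ltW at_)/=; have [tb|bt] := leP t b; first by rewrite (le_trans tb bx).
  by rewrite srho ?in_itv/= ?negb_and -?leNgt ?(ltW bt) ?orbT//; case: ifP.
have tPhi : test_function Phi.
  apply: (@test_function_itv _ _ a b) => // x xab; apply: sPhi.
  by apply: contra xab; exact: subset_itv_oo_cc.
have iuphi := integrable_continuousM iu cphi.
have iutheta := integrable_continuousM iu ctheta.
have := u0 Phi tPhi sPhi; rewrite Phi'.
rewrite (_ : (fun x => u x * rho x) =
   (fun x => u x * phi x + - k * (u x * theta x))); last first.
  by apply/funext => x; rewrite /rho; ring.
rewrite RintegralD//; last exact: integrable_scale.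
rewrite RintegralZl// => H.
under eq_Rintegral do rewrite mulrDl.
rewrite RintegralD//; last by apply: integrable_scale => //; exact: cont_int.
rewrite RintegralZl//; last exact: cont_int.
by rewrite -{}[RHS]H; congr (_ + _); rewrite /c /k; ring.
Qed.

Lemma locally_integrable_itv u a b : locally_integrable setT u ->
  leb.-integrable `[a, b] (EFin \o u).
Proof.
move=> [mu _ iu]; apply/integrableP; split.
  by apply/measurable_EFinP; exact: measurable_funTS.
by apply: iu => //; exact: segment_compact.
Qed.

Definition real_weak_derivative u v : Prop :=
  [/\ locally_integrable setT u, locally_integrable setT v &
  forall phi, test_function phi ->
    \int[leb]_x (u x * (phi^`())%classic x) = - \int[leb]_x (v x * phi x)].

(** Let [V] be the primitive of [v] from [a]. Then [u - V] has zero weak derivative on []a, b[],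
    hence is almost everywhere a constant there. *)
Lemma real_weak_derivative_primitive u v a b : a < b ->
  real_weak_derivative u v ->
  exists2 F, primitive_on a b F v & {ae leb, forall x, x \in `]a, b[ -> u x = F x}.
Proof.
move=> ab [lu lv uv].
have iu := locally_integrable_itv a b lu; have iv := locally_integrable_itv a b lv.
pose V x := \int[leb]_(t in `[a, x]) v t.
have pV c : primitive_on a b (fun x => c + V x) v.
  by split=> // x _; rewrite /V set_itv1 Rintegral_set1 addr0.
have iV : leb.-integrable `[a, b] (EFin \o V).
  have i1 : leb.-integrable `[a, b] (EFin \o cst 1).
    by apply: integrable_continuous_itv => x; exact: cvg_cst.
  have := integrable_mul_primitive (pV 0) i1.
  by apply: eq_integrable => // x _; rewrite /= mul1r add0r.
have [||c uc] := @du_Bois_Reymond (fun x => u x + - 1 * V x) a b ab.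
- by apply: integrable_add => //; exact: integrable_scale.
- move=> phi tphi sphi; have [Cphi _] := tphi.
  have cphi := Cn_continuous (Cphi 0).
  have cphi' : continuous (phi^`())%classic.
    by have /CnS[_ /Cn_continuous] := Cphi 1.
  have := uv phi tphi.
  rewrite (Rintegral_supported _ (supported_deriv sphi)).
  rewrite (@Rintegral_supported _ _ _ a b); last first.
    move=> x xab; apply: sphi; apply: contra xab; exact: subset_itv_oo_cc.
  (* The product rule for [V phi], read at [b]: since [phi] vanishes at both ends, [phi' V + v phi]
     has integral zero. *)
  have [_ /(_ b)] := primitive_onM (pV 0) (primitive_on_Cn1 a b (Cphi 1)).
  rewrite in_itv/= lexx (ltW ab) => /(_ isT) /=.
  have -> : phi a = 0 by apply: sphi; rewrite in_itv/= ltxx.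
  have -> : phi b = 0 by apply: sphi; rewrite in_itv/= ltxx andbF.
  rewrite !mulr0 add0r => H1 H2.
  have iphi' : leb.-integrable `[a, b] (EFin \o (phi^`())%classic).
    exact: integrable_continuous_itv.
  have iVphi' := integrable_mul_primitive (pV 0) iphi'.
  have ivphi := integrable_continuousM iv cphi.
  rewrite RintegralD// in H1.
  transitivity (\int[leb]_(x in `[a, b])
     (u x * (phi^`())%classic x + - 1 * ((phi^`())%classic x * (0 + V x)))).
    by apply: eq_Rintegral => x _; ring.
  rewrite RintegralD//; last 2 first.
    exact: integrable_continuousM.
    exact: integrable_scale.
  rewrite RintegralZl// H2 -[RHS]oppr0 [in RHS]H1; ring.
exists (fun x => c + V x) => //.
by apply: ae_lebesgueS uc => x H /H <-; rewrite mulN1r subrK.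
Qed.

End weak_derivatives_of_real_functions.

(** * Almost everywhere equality and integration by parts for squares *)

Section ae_transfer.
Context {R : realType}.
Local Notation leb := (@lebesgue_measure R).
Implicit Types (a b c x : R) (f g u v F : R -> R).

Lemma ae_neq a : {ae leb, forall x, x != a}.
Proof.
exists [set a]; split; first exact: measurable_set1.
  exact: lebesgue_measure_set1.
by move=> x /= /negP; rewrite negbK => /eqP.
Qed.

Lemma ae_eq_integrable_itv f g a b :
  measurable_fun (setT : set (measurableTypeR R)) f ->
  leb.-integrable `[a, b] (EFin \o g) ->
  {ae leb, forall x, x \in `]a, b[ -> f x = g x} ->
  leb.-integrable `[a, b] (EFin \o f) /\
  \int[leb]_(x in `[a, b]) f x = \int[leb]_(x in `[a, b]) g x.
Proof.
move=> mf ig fg.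
have mf' : measurable_fun (`[a, b]%classic : set (measurableTypeR R)) (EFin \o f).
  by apply/measurable_EFinP; exact: measurable_funTS.
have [mg goo] := integrableP _ _ _ ig.
have fg' : ae_eq leb `[a, b]%classic (EFin \o f) (EFin \o g).
  apply: ae_lebesgueS (ae_lebesgueI fg (ae_lebesgueI (ae_neq a) (ae_neq b))).
  move=> x [H [xa xb]] /=; rewrite in_itv/= => /andP[ax bx]; rewrite H//.
  by rewrite in_itv/= !lt_neqAle ax bx eq_sym xa xb.
split.
  apply/integrableP; split=> //; apply: le_lt_trans goo.
  rewrite (@ge0_ae_eq_integral _ _ _ leb `[a, b]%classic
    (fun x => `|(EFin \o f) x|%E) (fun x => `|(EFin \o g) x|%E))//.
  - exact: measurableT_comp.
  - exact: measurableT_comp.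
  - by apply: ae_lebesgueS fg' => x H xab; rewrite H.
by rewrite /Rintegral; congr fine; exact: ae_eq_integral.
Qed.

(* Since [u] has an absolutely continuous representative, so does
   [u ^+ 2 * psi], whose derivative is integrated here. *)
Lemma weak_derivative_sqr_by_parts u v psi a b : a < b ->
  real_weak_derivative u v -> Cn 1 psi -> psi a = 0 -> psi b = 0 ->
  let P x := 2 * u x * v x * psi x + u x ^+ 2 * (psi^`())%classic x in
  leb.-integrable `[a, b] (EFin \o P) /\ \int[leb]_(x in `[a, b]) P x = 0.
Proof.
move=> ab uv Cpsi pa pb P; have [F Fv uF] := real_weak_derivative_primitive ab uv.
have [[mu _ _] [mv _ _] _] := uv.
have [iQ HQ] := primitive_onM (primitive_onM Fv Fv) (primitive_on_Cn1 a b Cpsi).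
have mpsi : measurable_fun setT psi.
  by apply: continuous_measurable_fun; exact: Cn_continuous Cpsi.
have mpsi' : measurable_fun setT (psi^`())%classic.
  by have /CnS[_ [_ cpsi']] := Cpsi; exact: continuous_measurable_fun.
have mP : measurable_fun (setT : set (measurableTypeR R)) P.
  apply: measurable_funD; apply: measurable_funM => //.
    by apply: measurable_funM => //; apply: measurable_funM.
  exact: measurable_funX.
have PQ : {ae leb, forall x, x \in `]a, b[ -> P x =
    (psi^`())%classic x * (F \* F) x + (v x * F x + v x * F x) * psi x}.
  by apply: ae_lebesgueS uF => x H /H; rewrite /P /= => ->; ring.
have [iP ->] := ae_eq_integrable_itv mP iQ PQ; split=> //.
have := HQ b; rewrite in_itv/= lexx (ltW ab) => /(_ isT).
by rewrite /= pa pb !mulr0 add0r => <-.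
Qed.

End ae_transfer.

(** * Removing the cutoff by Fatou's lemma *)

Section cutoff.
Context {R : realType}.
Local Notation leb := (@lebesgue_measure R).
Implicit Types (b x : R) (p q P : R -> R).

(** Only its restriction to [[- b, b]] matters: it vanishes at the ends, so a polynomial replaces a
    compactly supported cutoff, and its derivative is at most 2 in absolute value when [b >= 1]. *)
Definition cutoff b x : R := 1 - x ^+ 2 / b ^+ 2.

Lemma cutoff_itv b x : 0 < b -> x \in `[- b, b] -> 0 <= cutoff b x <= 1.
Proof.
rewrite in_itv/= /cutoff => b0 /andP[bx xb].
rewrite subr_ge0 lerBlDr lerDl divr_ge0 ?sqr_ge0// andbT.
rewrite ler_pdivrMr ?exprn_gt0// mul1r; nra.
Qed.

Lemma cvg_cutoff x : cutoff n.+1%:R x @[n --> \oo] --> (1 : R).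
Proof.
rewrite -[X in _ --> X]subr0; apply: cvgB; first exact: cvg_cst.
rewrite (_ : (fun n => _) = (fun n => x ^+ 2 * (n.+1%:R^-1 * n.+1%:R^-1))); last first.
  by apply/funext => n; rewrite -invfM -expr2.
rewrite -(mulr0 (x ^+ 2)); apply: cvgMr; rewrite -(mulr0 0).
by apply: cvgM; exact: cvg_harmonic.
Qed.

(** [P] stands for the exact derivative left by an integration by parts, which contributes nothing
    on [[- b, b]]. Hence the integral of [cutoff^2 p] is at most that of [|q|], whatever [b] is, and
    Fatou's lemma along [b = n + 1] applies. *)
Lemma cutoff_integrable p q : measurable_fun [set: R] p ->
  (forall x, 0 <= p x) -> leb.-integrable setT (EFin \o q) ->
  (forall b, 1 <= b -> exists P,
    [/\ leb.-integrable `[- b, b] (EFin \o P),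
      \int[leb]_(x in `[- b, b]) P x = 0 &
      forall x, x \in `[- b, b] -> cutoff b x ^+ 2 * p x <= q x + P x]) ->
  leb.-integrable setT (EFin \o p).
Proof.
move=> mp p0 iq Hb.
pose D n : set (measurableTypeR R) := `[- n.+1%:R, n.+1%:R]%classic.
have mD n : measurable (D n) by exact: measurable_itv.
pose f n (x : measurableTypeR R) := (((fun x => cutoff n.+1%:R x ^+ 2 * p x) \_ (D n)) x)%:E.
have mc n : measurable_fun (setT : set (measurableTypeR R)) (cutoff n.+1%:R).
  by apply: measurable_funB => //; apply: measurable_funM => //; exact: measurable_funX.
have mcp n : measurable_fun (setT : set (measurableTypeR R)) (fun x => cutoff n.+1%:R x ^+ 2 * p x).
  by apply: measurable_funM => //; exact: measurable_funX.
have f0 n x : (0 <= f n x)%E.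
  rewrite lee_fin patchE; case: ifPn => // _; exact: mulr_ge0 (sqr_ge0 _) (p0 x).
have mf n : measurable_fun setT (f n).
  apply/measurable_EFinP; apply/(measurable_restrictT _ _).1 => //.
  exact: measurable_funTS.
have fM n : (\int[leb]_x f n x <= \int[leb]_x `|q x|%:E)%E.
  have n1 : 1 <= n.+1%:R :> R by rewrite ler1n.
  have [P [iP P0 H]] := Hb _ n1.
  have iqD : leb.-integrable (D n) (EFin \o q) by exact: integrableS iq.
  have iqP : leb.-integrable (D n) (EFin \o (fun x => q x + P x)).
    exact: integrable_add.
  have -> : (\int[leb]_x f n x =
      \int[leb]_(x in D n) (cutoff n.+1%:R x ^+ 2 * p x)%:E)%E.
    rewrite [RHS]integral_mkcond; apply: eq_integral => x _.
    by rewrite /f /= !patchE; case: ifP.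
  apply: (@le_trans _ _ (\int[leb]_(x in D n) (q x + P x)%:E)%E).
    apply: le_integral => //.
      apply: (le_integrable _ _ _ iqP) => //.
        by apply/measurable_EFinP; exact: measurable_funTS.
      move=> x /= xD; rewrite lee_fin ger0_norm; last first.
        by rewrite mulr_ge0// sqr_ge0.
      by rewrite (le_trans (H x xD))// ler_norm.
    by move=> x; rewrite inE => xD; rewrite lee_fin; exact: H.
  have -> : (\int[leb]_(x in D n) (q x + P x)%:E = \int[leb]_(x in D n) (q x)%:E)%E.
    rewrite -[LHS]fineK ?integrable_fin_num// -[RHS]fineK ?integrable_fin_num//.
    by congr EFin; rewrite -/(Rintegral _ _ _) RintegralD// P0 addr0.
  apply: (@le_trans _ _ (\int[leb]_(x in D n) `|q x|%:E)%E).
    apply: le_integral => //; first exact: integrable_norm.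
    by move=> x _; rewrite lee_fin ler_norm.
  apply: ge0_subset_integral => //.
  by apply/measurable_EFinP; apply: measurableT_comp => //; apply/measurable_EFinP;
    case/integrableP: iq.
have limf x : limn_einf (f ^~ x) = (p x)%:E.
  suff cf : f n x @[n --> \oo] --> (p x)%:E.
    by rewrite is_cvg_limn_einfE; [exact/cvg_lim|apply/cvg_ex; exists (p x)%:E].
  apply: cvg_EFin; first exact: nearW.
  have cp : cutoff n.+1%:R x ^+ 2 * p x @[n --> \oo] --> p x.
    have cc := cvg_cutoff x.
    have := cvgM (cvgM cc cc) (cvg_cst (p x)).
    by rewrite !mul1r; apply.
  apply: cvg_trans cp; apply: near_eq_cvg; near=> n.
  rewrite /f /= patchE ifT// inE /D /= in_itv/= -ler_norml.
  have : `|x| <= n%:R by near: n; exact: nbhs_infty_ger.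
  by move=> /le_trans; apply; rewrite ler_nat.
have := fatou leb measurableT mf (fun n x _ => f0 n x).
under eq_integral do rewrite limf.
move=> H; apply/integrableP; split; first exact/measurable_EFinP.
apply: (@le_lt_trans _ _ (\int[leb]_x `|q x|%:E)%E); last first.
  by case/integrableP: iq.
rewrite (_ : (\int[leb]_x `|(EFin \o p) x| = \int[leb]_x (p x)%:E)%E); last first.
  by apply: eq_integral => x _; rewrite /= ger0_norm.
apply: (le_trans H).
rewrite limn_einf_lim; apply: lime_le; first exact: is_cvg_einfs.
apply: nearW => n; apply: le_trans (fM n); apply: ereal_inf_lbound.
by exists n => /=.
Unshelve. all: by end_near. Qed.

End cutoff.

(** * Energy estimates in the weighted space *)

Section pointwise_energy.
Context {R : realFieldType}.
Implicit Types (a w z s t X D e delta A eps : R).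

(** Here [s], [t] are a function and its derivative, [z], [w] are [U'] and [U''], [X], [D] the
    cutoff and its derivative, and [e] is [e^(-U)]. The last summand has integral zero by
    [weight_test_by_parts]. *)
Lemma cutoff_energy_deriv a w z s t X D e : 0 <= e -> 0 <= X -> X <= 1 ->
  D ^+ 2 <= 4 -> a <= w ->
  X ^+ 2 * (2^-1 * (t ^+ 2 * e)) <=
  3 / 2 * ((t - z * s) ^+ 2 * e) + (`|a| + 16) * (s ^+ 2 * e) +
  (2 * s * t * (X ^+ 2 * z) +
   s ^+ 2 * (2 * X * D * z + X ^+ 2 * (w - z ^+ 2))) * e.
Proof.
move=> e0 X0 X1 D4 aw.
suff H : X ^+ 2 * (2^-1 * t ^+ 2) <=
    3 / 2 * (t - z * s) ^+ 2 + (`|a| + 16) * s ^+ 2 +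
    (2 * s * t * (X ^+ 2 * z) +
     s ^+ 2 * (2 * X * D * z + X ^+ 2 * (w - z ^+ 2))).
  by have := ler_wpM2r e0 H; lra.
have X2 : X ^+ 2 <= 1 by rewrite expr_le1.
have A1 : 0 <= s ^+ 2 * X ^+ 2 * (w - a).
  by rewrite mulr_ge0 ?subr_ge0// mulr_ge0 ?sqr_ge0.
have A2 : - a * (s ^+ 2 * X ^+ 2) <= `|a| * s ^+ 2.
  apply: (@le_trans _ _ (`|a| * (s ^+ 2 * X ^+ 2))).
    apply: ler_wpM2r; first by rewrite mulr_ge0 ?sqr_ge0.
    by rewrite -normrN ler_norm.
  by rewrite ler_wpM2l// ler_piMr ?sqr_ge0.
have A3 : s ^+ 2 * D ^+ 2 <= s ^+ 2 * 4 by rewrite ler_wpM2l ?sqr_ge0.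
(* Young's inequality for the cutoff error, at the price of [4 D^2 s^2], hence of the constant
   16. *)
have A4 := sqr_ge0 (X * (z * s) / 2 + 2 * D * s).
(* With [h = t - z s] this gives [(z s)^2 / 4 <= (t^2 + h^2) / 2] with weight [X^2]: half of [t^2]
   is lost, and the factor of [h^2] grows from 1 to 3/2. *)
have A5 := sqr_ge0 (X * (t + (t - z * s))).
have A6 : 0 <= (1 - X ^+ 2) * (t - z * s) ^+ 2.
  by rewrite mulr_ge0 ?sqr_ge0// subr_ge0.
by move: (`|a|) A2 => na A2; lra.
Qed.

(** Same notation, with the null integrand taken with the opposite sign. The bound on [w] leaves
    [1 - delta = 4 eps] times [X^2 (z s)^2]; two uses of Young's inequality cost [eps] each, so that
    [2 eps = (1 - delta) / 2] remains. *)
Lemma cutoff_energy_mul delta A eps w z s t X D e :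
  eps = (1 - delta) / 4 -> delta < 1 -> 0 < A ->
  0 <= e -> 0 <= X -> X <= 1 -> D ^+ 2 <= 4 -> w <= delta * z ^+ 2 + A ->
  X ^+ 2 * ((1 - delta) / 2 * ((z * s) ^+ 2 * e)) <=
  eps^-1 * (t ^+ 2 * e) + (A + 4 / eps) * (s ^+ 2 * e) +
  - 1 * ((2 * s * t * (X ^+ 2 * z) +
   s ^+ 2 * (2 * X * D * z + X ^+ 2 * (w - z ^+ 2))) * e).
Proof.
move=> epsE d1 A0 e0 X0 X1 D4 wA; have eps0 : 0 < eps by lra.
suff H : X ^+ 2 * ((1 - delta) / 2 * (z * s) ^+ 2) <=
    eps^-1 * t ^+ 2 + (A + 4 / eps) * s ^+ 2 +
    - 1 * (2 * s * t * (X ^+ 2 * z) +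
      s ^+ 2 * (2 * X * D * z + X ^+ 2 * (w - z ^+ 2))).
  by have := ler_wpM2r e0 H; move: (eps^-1) => ei; lra.
have X2 : X ^+ 2 <= 1 by rewrite expr_le1.
have A1 : 0 <= s ^+ 2 * X ^+ 2 * (delta * z ^+ 2 + A - w).
  by rewrite mulr_ge0 ?subr_ge0// mulr_ge0 ?sqr_ge0.
have A2 : A * (s ^+ 2 * X ^+ 2) <= A * s ^+ 2.
  by rewrite ler_wpM2l ?(ltW A0)// ler_piMr ?sqr_ge0.
have A3 : s ^+ 2 * D ^+ 2 / eps <= s ^+ 2 * 4 / eps.
  by rewrite ler_wpM2r ?invr_ge0 ?(ltW eps0)// ler_wpM2l ?sqr_ge0.
have young (p q : R) : 2 * p * q <= eps * p ^+ 2 + q ^+ 2 / eps.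
  rewrite -subr_ge0 (_ : _ - _ = (eps * p - q) ^+ 2 / eps).
    by rewrite mulr_ge0 ?sqr_ge0// invr_ge0 ltW.
  by field; rewrite gt_eqF.
have A4 := young (X * z * s) (X * t).
have A5 := young (X * z * s) (D * s).
have A6 : X ^+ 2 * t ^+ 2 / eps <= t ^+ 2 / eps.
  by rewrite ler_wpM2r ?invr_ge0 ?(ltW eps0)// ler_piMl ?sqr_ge0.
have de : delta = 1 - 4 * eps by lra.
rewrite {}de in A1 *.
by move: (eps^-1) A3 A4 A5 A6 => ei A3 A4 A5 A6; lra.
Qed.

End pointwise_energy.

(** * Real functions in L^2(nu) and integration by parts against the weight *)

Section weighted_L2.
Context {R : realType} (U : R -> R) (hU : Cn 2 U).
Local Notation leb := (@lebesgue_measure R).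
Local Notation U' := ((U^`())%classic).
Local Notation U'' := ((U^`(2))%classic).
Implicit Types (a b c x : R) (u v h q : R -> R).

(** The density of nu is kept inside a Lebesgue integral, so that it can be differentiated when
    integrating by parts. *)
Definition weighted_L2 u : Prop := measurable_fun [set: R] u /\
  leb.-integrable setT (EFin \o (fun x => u x ^+ 2 * expR (- U x))).

Let contU : continuous U.
Proof. exact: Cn_continuous hU. Qed.

Let contU' : continuous U'.
Proof. by have /CnS[_ /Cn_continuous] := hU. Qed.

Let contU'' : continuous U''.
Proof. by have [] := hU. Qed.

Lemma continuous_expRN : continuous (fun x => expR (- U x)).
Proof.
move=> x; apply: (@continuous_comp _ _ _ (fun x => - U x) expR).
  by apply: continuousN; exact: contU.
exact: continuous_expR.
Qed.

Let mweight : measurable_fun [set: R] (fun x => expR (- U x)).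
Proof. exact: continuous_measurable_fun continuous_expRN. Qed.

Lemma weighted_L2_le v q : measurable_fun [set: R] v ->
  leb.-integrable setT (EFin \o q) ->
  (forall x, v x ^+ 2 * expR (- U x) <= q x) -> weighted_L2 v.
Proof.
move=> mv iq vq; split=> //; apply: le_integrable iq => //.
  apply/measurable_EFinP; apply: measurable_funM => //.
  exact: measurable_funX.
move=> x _; rewrite lee_fin ger0_norm ?(mulr_ge0 (sqr_ge0 _) (expR_ge0 _))//.
by rewrite (le_trans (vq x))// ler_norm.
Qed.

Lemma weighted_L2_dom u v : weighted_L2 u -> measurable_fun [set: R] v ->
  (forall x, `|v x| <= `|u x|) -> weighted_L2 v.
Proof.
move=> [_ iu] mv vu; apply: (weighted_L2_le mv iu) => x.
rewrite ler_wpM2r ?expR_ge0// -(real_normK (num_real (v x))).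
by rewrite -(real_normK (num_real (u x))) lerXn2r ?nnegrE.
Qed.

Lemma weighted_L2Z c u : weighted_L2 u -> weighted_L2 (fun x => c * u x).
Proof.
move=> [mu iu]; split; first exact: measurable_funM.
have := integrable_scale (c ^+ 2) measurableT iu.
by apply: eq_integrable => // x _; rewrite /= exprMn mulrA.
Qed.

Lemma weighted_L2D u v : weighted_L2 u -> weighted_L2 v ->
  weighted_L2 (fun x => u x + v x).
Proof.
move=> [mu iu] [mv iv].
have i2 := integrable_add measurableT (integrable_scale 2 measurableT iu)
  (integrable_scale 2 measurableT iv).
apply: (weighted_L2_le _ i2) => [|x]; first exact: measurable_funD.
rewrite [leRHS](_ : _ = (2 * u x ^+ 2 + 2 * v x ^+ 2) * expR (- U x)); last ring.
rewrite ler_wpM2r ?expR_ge0//.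
by have := sqr_ge0 (u x - v x); lra.
Qed.

Lemma weighted_L2B u v : weighted_L2 u -> weighted_L2 v ->
  weighted_L2 (fun x => u x - v x).
Proof.
move=> lu lv; have := weighted_L2D lu (weighted_L2Z (-1) lv).
by congr weighted_L2; apply/funext => x; rewrite mulN1r.
Qed.

(** Measurability of [v] is a hypothesis because almost everywhere equality does not transfer Borel
    measurability. *)
Lemma weighted_L2_ae u v : weighted_L2 u -> measurable_fun [set: R] v ->
  {ae leb, forall x, u x = v x} -> weighted_L2 v.
Proof.
move=> [mu iu] mv uv; split=> //.
have m (w : R -> R) : measurable_fun [set: R] w -> measurable_fun
    (setT : set (measurableTypeR R)) (fun x => (w x ^+ 2 * expR (- U x))%:E).
  move=> mw; apply/measurable_EFinP; apply: measurable_funM => //.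
  exact: measurable_funX.
apply/integrableP; split; first exact: m.
have [_ ] := integrableP _ _ _ iu; apply: le_lt_trans.
rewrite le_eqVlt; apply/orP; left; apply/eqP.
apply: ge0_ae_eq_integral => //.
- by apply: measurableT_comp => //; exact: m.
- by apply: measurableT_comp => //; exact: m.
- by apply: ae_lebesgueS uv => x /= ->.
Qed.

Lemma is_derive_weight x : is_derive x 1 (fun y => expR (- U y)) (- U' x * expR (- U x)).
Proof.
have dU : is_derive x 1 U (U' x).
  by rewrite derive1E; apply: derivableP; exact: Cn_derivable hU.
by rewrite mulrC; exact: (@is_derive1_comp _ expR _ x _ _ (is_derive_expR _) (is_deriveN dU)).
Qed.

Lemma is_derive_cutoff b x : is_derive x 1 (cutoff b) (- (2 * x / b ^+ 2)).
Proof.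
have d2 : is_derive x 1 ((id : R -> R) * id) (2 * x).
  apply: is_derive_eq (is_deriveM (is_derive_id x 1) (is_derive_id x 1)) _.
  by rewrite /GRing.scale/=; ring.
have := is_deriveB (is_derive_cst (1 : R) x (1 : R)) (is_deriveZ (b ^+ 2)^-1 d2).
rewrite (_ : _ - _ *: _ = cutoff b); last first.
  by apply/funext => y; rewrite /cutoff [y ^+ 2 / _]mulrC expr2.
by move=> H; apply: is_derive_eq H _; rewrite sub0r /GRing.scale/= mulrC.
Qed.

Lemma continuous_cutoff b : continuous (cutoff b).
Proof.
move=> x; apply: differentiable_continuous; apply/derivable1_diffP.
by have [] := is_derive_cutoff b x.
Qed.

(** Integrating the derivative of [u^2] against this function produces [2 u v U' e^(-U)], the cross
    term of [(v - U' u)^2 e^(-U)], localised by the cutoff. *)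
Definition weight_test b x : R := cutoff b x ^+ 2 * U' x * expR (- U x).

Definition weight_test_deriv b x : R :=
  (2 * cutoff b x * - (2 * x / b ^+ 2) * U' x +
   cutoff b x ^+ 2 * (U'' x - U' x ^+ 2)) * expR (- U x).

Lemma is_derive_weight_test b x :
  is_derive x 1 (weight_test b) (weight_test_deriv b x).
Proof.
have dU' : is_derive x 1 U' (U'' x).
  rewrite derive1nS derive1n1 derive1E; apply: derivableP.
  by have /CnS[_ /Cn_derivable] := hU; exact.
have dc := is_derive_cutoff b x; have dw := is_derive_weight x.
apply: is_derive_eq (is_deriveM (is_deriveM (is_deriveM dc dc) dU') dw) _.
by rewrite /weight_test_deriv !fctE /GRing.scale/=; ring.
Qed.

Lemma Cn1_weight_test b : Cn 1 (weight_test b).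
Proof.
apply/CnS; split=> [x|]; first by have [] := is_derive_weight_test b x.
split=> //; rewrite derive1n0.
rewrite (_ : (_^`())%classic = weight_test_deriv b); last first.
  by apply/funext => x; rewrite derive1E; have [_ ->] := is_derive_weight_test b x.
have cc := @continuous_cutoff b; have cw := continuous_expRN.
have cm (f g : R -> R) : continuous f -> continuous g ->
    continuous (fun x => f x * g x).
  by move=> cf cg x; apply: continuousM; [exact: cf|exact: cg].
have cD (f g : R -> R) : continuous f -> continuous g ->
    continuous (fun x => f x + g x).
  by move=> cf cg x; apply: continuousD; [exact: cf|exact: cg].
have ct (r : R) : continuous (fun _ : R => r) by move=> x; exact: cvg_cst.
have c2 (f : R -> R) : continuous f -> continuous (fun x => f x ^+ 2).
  by move=> cf; under eq_fun do rewrite expr2; exact: cm.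
have cN (f : R -> R) : continuous f -> continuous (fun x => - f x).
  by move=> cf x; apply: continuousN; exact: cf.
apply: (cm _ _ _ cw); apply: (cD _ _).
  apply: (cm _ _ _ contU'); apply: (cm (fun x => 2 * cutoff b x)); first exact: cm.
  apply: (cN (fun x => 2 * x / b ^+ 2)); apply: (cm (fun x => 2 * x)) => //.
  by apply: (cm (fun=> 2)) => // x; exact: cvg_id.
apply: (cm (fun x => cutoff b x ^+ 2)); first exact: c2.
by apply: cD => //; apply: cN; exact: c2.
Qed.

Lemma weight_test_by_parts u v b : 1 <= b -> real_weak_derivative u v ->
  let P x := (2 * u x * v x * (cutoff b x ^+ 2 * U' x) + u x ^+ 2 *
     (2 * cutoff b x * - (2 * x / b ^+ 2) * U' x +
      cutoff b x ^+ 2 * (U'' x - U' x ^+ 2))) * expR (- U x) in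
  leb.-integrable `[- b, b] (EFin \o P) /\ \int[leb]_(x in `[- b, b]) P x = 0.
Proof.
move=> b1 uv P; have b0 : 0 < b by exact: lt_le_trans b1.
have bb : - b < b by lra.
have c0 y : y ^+ 2 = b ^+ 2 -> weight_test b y = 0.
  move=> yb; rewrite /weight_test /cutoff yb divff ?subrr ?expr0n ?mul0r//.
  by rewrite expf_neq0// gt_eqF.
have [iQ HQ] := weak_derivative_sqr_by_parts bb uv (Cn1_weight_test b)
  (c0 _ (sqrrN _)) (c0 _ erefl).
have QP : (fun x => 2 * u x * v x * weight_test b x +
    u x ^+ 2 * ((weight_test b)^`())%classic x) = P.
  apply/funext => x; rewrite derive1E.
  have [_ ->] := is_derive_weight_test b x.
  by rewrite /P /weight_test /weight_test_deriv; ring.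
by rewrite QP in iQ HQ.
Qed.

Lemma cutoff_deriv_le b x : 1 <= b -> x \in `[- b, b] ->
  (- (2 * x / b ^+ 2)) ^+ 2 <= 4.
Proof.
move=> b1; rewrite in_itv/= => /andP[bx xb]; have b0 : 0 < b by exact: lt_le_trans b1.
have b20 : 0 < b ^+ 2 by rewrite exprn_gt0.
rewrite sqrrN expr_div_n ler_pdivrMr ?exprn_gt0//.
have x2b : x ^+ 2 <= b ^+ 2 by nra.
have b21 : 1 <= b ^+ 2 by nra.
by nra.
Qed.

(* Integrating [2 U' u v e^(-U)] by parts,
   [int (v - U' u)^2 e^(-U) = int (v^2 + U'' u^2) e^(-U)]. *)
Lemma weighted_L2_deriv a u v : (forall x, a <= U'' x) ->
  real_weak_derivative u v -> weighted_L2 u ->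
  weighted_L2 (fun x => v x - U' x * u x) -> weighted_L2 v.
Proof.
move=> aU uv [_ iu] [_ ih]; have [_ [mv _ _] _] := uv; split=> //.
have ihalf : leb.-integrable setT
    (EFin \o (fun x => 2^-1 * (v x ^+ 2 * expR (- U x)))).
  apply: (@cutoff_integrable _ _
    (fun x => 3 / 2 * ((v x - U' x * u x) ^+ 2 * expR (- U x)) +
              (`|a| + 16) * (u x ^+ 2 * expR (- U x)))).
  - by apply: measurable_funM => //; apply: measurable_funM => //; exact: measurable_funX.
  - by move=> x; rewrite mulr_ge0// mulr_ge0 ?sqr_ge0 ?expR_ge0.
  - by apply: integrable_add => //; exact: integrable_scale.
  move=> b b1; have [iP HP] := weight_test_by_parts b1 uv.
  eexists; split; [exact: iP|exact: HP|] => x xb.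
  have D4 := cutoff_deriv_le b1 xb.
  have /cutoff_itv /(_ xb) /andP[X0 X1] : 0 < b by exact: lt_le_trans b1.
  exact: cutoff_energy_deriv.
have := integrable_scale 2 measurableT ihalf.
by apply: eq_integrable => // x _; rewrite /= mulrA divff// mul1r.
Qed.

(** The Hardy-type bound. Differentiating the weight produces [- U'^2 u^2], and [U''] compensates at
    most the fraction [delta] of it up to [A u^2]. *)
Lemma weighted_L2_mul_deriv delta A u v : delta < 1 -> 0 < A ->
  (forall x, U'' x <= delta * U' x ^+ 2 + A) ->
  real_weak_derivative u v -> weighted_L2 u -> weighted_L2 v ->
  weighted_L2 (fun x => U' x * u x).
Proof.
move=> d1 A0 UA uv [_ iu] [_ iv]; have [[mu _ _] [mv _ _] _] := uv.
have mU' : measurable_fun [set: R] U' by exact: continuous_measurable_fun.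
have mz : measurable_fun [set: R] (fun x => U' x * u x) by exact: measurable_funM.
split=> //.
pose eps := (1 - delta) / 4.
pose k := (1 - delta) / 2; have k0 : 0 < k by rewrite /k; lra.
have ik : leb.-integrable setT
    (EFin \o (fun x => k * ((U' x * u x) ^+ 2 * expR (- U x)))).
  apply: (@cutoff_integrable _ _
    (fun x => eps^-1 * (v x ^+ 2 * expR (- U x)) +
              (A + 4 / eps) * (u x ^+ 2 * expR (- U x)))).
  - by apply: measurable_funM => //; apply: measurable_funM => //; exact: measurable_funX.
  - by move=> x; rewrite mulr_ge0 ?(ltW k0)// mulr_ge0 ?sqr_ge0 ?expR_ge0.
  - by apply: integrable_add => //; exact: integrable_scale.
  move=> b b1; have [iP HP] := weight_test_by_parts b1 uv.
  (* The null integrand enters with a minus sign, as in [cutoff_energy_mul]. *)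
  eexists; split; [exact: (integrable_scale (-1) _ iP)| |] => [|x xb].
    by rewrite RintegralZl// HP mulr0.
  have D4 := cutoff_deriv_le b1 xb.
  have /cutoff_itv /(_ xb) /andP[X0 X1] : 0 < b by exact: lt_le_trans b1.
  exact: cutoff_energy_mul.
have := integrable_scale k^-1 measurableT ik.
by apply: eq_integrable => // x _; rewrite /= mulrA mulVf ?gt_eqF// mul1r.
Qed.

End weighted_L2.

(** * Reflection and algebra of weak derivatives *)

Section reflection.
Context {R : realType}.
Local Notation leb := (@lebesgue_measure R).
Implicit Types (a b c x : R) (f u v : R -> R).

Let mopp : measurable_fun setT (-%R : measurableTypeR R -> measurableTypeR R).
Proof. by apply: continuous_measurable_fun; exact: opp_continuous. Qed.

Let ge0_integral_opp (g : R -> \bar R) :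
  measurable_fun (setT : set (measurableTypeR R)) g -> (forall x, 0 <= g x)%E ->
  (\int[leb]_x g (- x)%R = \int[leb]_x g x)%E.
Proof.
move=> mg g0; rewrite (_ : [set: _] =
  (-%R : _ -> measurableTypeR R) @^-1` [set: measurableTypeR R]); last by [].
rewrite -ge0_integral_pushforward//=.
by apply: eq_measure_integral => //= A mA _; exact: lebesgue_measureN.
Qed.

Lemma integrable_opp f : leb.-integrable setT (EFin \o f) ->
  leb.-integrable setT (EFin \o (fun x => f (- x))) /\
  \int[leb]_x f (- x) = \int[leb]_x f x.
Proof.
move=> fi; have [mf foo] := integrableP _ _ _ fi.
have mfo : measurable_fun (setT : set (measurableTypeR R))
    (EFin \o (fun x => f (- x))).
  exact: (measurableT_comp mf mopp).
split.
  apply/integrableP; split=> //; move: foo.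
  by rewrite -(@ge0_integral_opp (fun x => `|(EFin \o f) x|%E))//; exact: measurableT_comp.
rewrite /Rintegral; congr fine; rewrite integralE [RHS]integralE; congr (_ - _)%E.
  rewrite -(@ge0_integral_opp (EFin \o f)^\+%E) => [||x]; last exact: funepos_ge0.
    by apply: eq_integral => x _; rewrite !funeposE.
  exact: measurable_funepos.
rewrite -(@ge0_integral_opp (EFin \o f)^\-%E) => [||x]; last exact: funeneg_ge0.
  by apply: eq_integral => x _; rewrite !funenegE.
exact: measurable_funeneg.
Qed.

(** Every compact set lies in a symmetric interval, and symmetric intervals are preserved by
    reflection. *)
Lemma locally_integrableP f : locally_integrable setT f <->
  measurable_fun [set: R] f /\
  forall b, leb.-integrable `[- b, b] (EFin \o f).
Proof.
split=> [lf|[mf fi]]; first by split=> [|b]; [case: lf|exact: locally_integrable_itv].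
split=> //; first exact: openT.
move=> K _ cK; have [M [_ HM]] := compact_bounded cK.
have KM : K `<=` `[- (M + 1), M + 1]%classic.
  by move=> x Kx /=; rewrite in_itv/= -ler_norml; apply: (HM (M + 1)); rewrite ?ltrDl.
have [mfM] := integrableP _ _ _ (fi (M + 1)); apply: le_lt_trans.
apply: ge0_subset_integral => //; first exact: compact_measurable.
by apply/measurable_EFinP; apply: measurableT_comp => //; exact/measurable_EFinP.
Qed.

Lemma locally_integrableZ c f : locally_integrable setT f ->
  locally_integrable setT (fun x => c * f x).
Proof.
move=> /locally_integrableP[mf fi]; apply/locally_integrableP; split=> [|b].
  exact: measurable_funM.
exact: integrable_scale.
Qed.

Lemma locally_integrable_opp f : locally_integrable setT f ->
  locally_integrable setT (fun x => f (- x)).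
Proof.
move=> /locally_integrableP[mf fi]; apply/locally_integrableP; split=> [|b].
  exact: (measurableT_comp mf mopp).
have /integrable_opp[+ _] :=
  (@integrable_patch _ `[- b, b]%classic f (measurable_itv _)).1 (fi b).
move=> H; apply/(@integrable_patch _ `[- b, b]%classic _ (measurable_itv _)).2.
move: H; apply: eq_integrable => // x _ /=.
by rewrite !patchE !mem_setE !in_itv/= lerNl opprK lerNl andbC.
Qed.

End reflection.

Section weak_derivative_algebra.
Context {R : realType}.
Local Notation leb := (@lebesgue_measure R).
Implicit Types (a b c x : R) (f g u v : R -> R).

Lemma test_function_supported f : test_function f ->
  exists2 b, 0 < b & supported f (- b) b.
Proof.
move=> [_ [K cK K0]]; have [M [_ HM]] := compact_bounded cK.
(* The support satisfies [|x| <= |M| + 1]; the additional 1 puts it inside the open interval. *)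
exists (`|M| + 2) => [|x xM]; first by rewrite ltr_wpDl.
apply: K0 => Kx; move/negP: xM; apply; rewrite in_itv/= -ltr_norml.
apply: (@le_lt_trans _ _ (`|M| + 1)); last by rewrite ltrD2l ltr1n.
by apply: (HM (`|M| + 1)) => //; rewrite (le_lt_trans (ler_norm M))// ltrDl.
Qed.

Lemma test_functionC f : test_function f ->
  continuous f /\ continuous (f^`())%classic.
Proof.
move=> [Cf _]; split; first exact: Cn_continuous (Cf 0).
by have /CnS[_ /Cn_continuous] := Cf 1.
Qed.

Lemma supported_cc f b : supported f (- b) b ->
  forall x, x \notin `[- b, b] -> f x = 0.
Proof.
by move=> sf x xb; apply: sf; apply: contra xb; exact: subset_itv_oo_cc.
Qed.

Lemma integrable_test u g b : locally_integrable setT u -> continuous g ->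
  (forall x, x \notin `[- b, b] -> g x = 0) ->
  leb.-integrable setT (EFin \o (fun x => u x * g x)).
Proof.
move=> lu cg g0.
have := integrable_continuousM (locally_integrable_itv (- b) b lu) cg.
move=> /(@integrable_patch _ `[- b, b]%classic _ (measurable_itv _)).1.
apply: eq_integrable => // x _ /=; rewrite patchE mem_setE.
by case: ifPn => // /g0 ->; rewrite mulr0.
Qed.

Lemma real_weak_derivativeD u v u' v' : real_weak_derivative u v ->
  real_weak_derivative u' v' ->
  real_weak_derivative (fun x => u x + u' x) (fun x => v x + v' x).
Proof.
move=> [lu lv uv] [lu' lv' uv']; split; try exact: locally_integrableD.
move=> phi tphi; have [b b0 sphi] := test_function_supported tphi.
have [cphi cphi'] := test_functionC tphi.
under eq_Rintegral do rewrite mulrDl.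
under [in RHS]eq_Rintegral do rewrite mulrDl.
have i w : locally_integrable setT w ->
    leb.-integrable setT (EFin \o (fun x => w x * (phi^`())%classic x)).
  by move=> lw; exact: integrable_test lw cphi' (supported_deriv sphi).
have j w : locally_integrable setT w ->
    leb.-integrable setT (EFin \o (fun x => w x * phi x)).
  by move=> lw; exact: integrable_test lw cphi (supported_cc sphi).
rewrite RintegralD//; [|exact: i|exact: i].
by rewrite RintegralD//; [|exact: j|exact: j]; rewrite uv// uv'// opprD.
Qed.

Lemma real_weak_derivativeZ c u v : real_weak_derivative u v ->
  real_weak_derivative (fun x => c * u x) (fun x => c * v x).
Proof.
move=> [lu lv uv]; split; try exact: locally_integrableZ.
move=> phi tphi; have [b b0 sphi] := test_function_supported tphi.
have [cphi cphi'] := test_functionC tphi.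
under eq_Rintegral do rewrite -mulrA.
under [in RHS]eq_Rintegral do rewrite -mulrA.
rewrite RintegralZl//; last exact: integrable_test lu cphi' (supported_deriv sphi).
rewrite RintegralZl//; last exact: integrable_test lv cphi (supported_cc sphi).
by rewrite uv// mulrN.
Qed.

Lemma test_function_opp f : test_function f -> test_function (fun x => f (- x)).
Proof.
move=> tf; have [b b0 sf] := test_function_supported tf; have [Cf _] := tf.
apply: (@test_function_itv _ _ (- b) b) => [n|x xb].
  have := Cn_comp_affine (-1) 0 (Cf n).
  by congr Cn; apply/funext => x; rewrite addr0 mulN1r.
apply: sf; apply: contra xb; rewrite !in_itv/= => /andP[bx xb].
by rewrite lerNl (ltW xb)/= -lerN2 (ltW bx).
Qed.

Lemma real_weak_derivative_opp u v : real_weak_derivative u v ->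
  real_weak_derivative (fun x => u (- x)) (fun x => - v (- x)).
Proof.
move=> [lu lv uv]; split; first exact: locally_integrable_opp.
  have := locally_integrableZ (-1) (locally_integrable_opp lv).
  by congr locally_integrable; apply/funext => x; rewrite mulN1r.
move=> phi tphi; have [b b0 sphi] := test_function_supported tphi.
have [cphi cphi'] := test_functionC tphi.
have tpsi := test_function_opp tphi; have [cpsi cpsi'] := test_functionC tpsi.
have [b' _ spsi] := test_function_supported tpsi.
have psi' x : ((fun x => phi (- x))^`())%classic x = - (phi^`())%classic (- x).
  have dphi : derivable phi (-1 * x + 0) 1 by have [Cphi _] := tphi; exact: Cn_derivable (Cphi 1).
  have [_ ] := is_derive_comp_affine dphi.
  rewrite addr0 !mulN1r => <-; rewrite derive1E; congr ('D_1 _ x).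
  by apply/funext => y; rewrite addr0 mulN1r.
have := uv _ tpsi.
have [_ <-] := integrable_opp (integrable_test lu cpsi' (supported_deriv spsi)).
have [ivpsi <-] := integrable_opp (integrable_test lv cpsi (supported_cc spsi)).
move=> H.
transitivity (- \int[leb]_x (-1 * (u (- x) * (phi^`())%classic x))).
  rewrite RintegralZl//; first by rewrite mulN1r opprK.
  exact: integrable_test (locally_integrable_opp lu) cphi' (supported_deriv sphi).
congr (- _); transitivity (\int[leb]_x (-1 * (v (- x) * phi (- - x)))).
  rewrite [RHS]RintegralZl// mulN1r -H.
  by apply: eq_Rintegral => x _; rewrite psi' opprK; ring.
by apply: eq_Rintegral => x _; rewrite opprK; ring.
Qed.

(** The fundamental lemma gives equality on each []- n, n[], and countably many null sets are
    discarded. *)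
Lemma real_weak_derivative_unique u v v' : real_weak_derivative u v ->
  real_weak_derivative u v' -> {ae leb, forall x, v x = v' x}.
Proof.
move=> [lu lv uv] [_ lv' uv'].
have lw : locally_integrable setT (fun x => v x + -1 * v' x).
  by apply: locally_integrableD => //; exact: locally_integrableZ.
have H n : {ae leb, forall x, x \in `]- n%:R, n%:R[ -> v x + -1 * v' x = 0}.
  apply: fundamental_lemma => [|phi tphi sphi]; first exact: locally_integrable_itv.
  have [cphi _] := test_functionC tphi.
  rewrite -Rintegral_supported; last exact: supported_cc.
  have := uv phi tphi; rewrite uv'// => /oppr_inj vv'.
  under eq_Rintegral do rewrite mulrDl -mulrA.
  rewrite RintegralD//; last 2 first.
  - exact: integrable_test lv cphi (supported_cc sphi).
  - by apply: integrable_scale => //; exact: integrable_test lv' cphi (supported_cc sphi).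
  rewrite RintegralZl//; last exact: integrable_test lv' cphi (supported_cc sphi).
  by rewrite vv' mulN1r subrr.
apply: ae_lebesgueS (ae_foralln H) => x Hx.
have := Hx (Num.truncn `|x|).+1; rewrite in_itv/= -ltr_norml truncnS_gt => /(_ isT).
by rewrite mulN1r => /subr0_eq.
Qed.

End weak_derivative_algebra.

(** * Integrals against nu and mu *)

Section zigzag_measures.
Context {R : realType} (U : R -> R) (mU : measurable_fun [set: R] U).
Local Notation leb := (@lebesgue_measure R).

Let mweight : measurable_fun (setT : set (measurableTypeR R))
  (fun x => (expR (- U x))%:E).
Proof.
by apply/measurable_EFinP; apply: measurableT_comp => //; exact: measurableT_comp.
Qed.

Import HBNNSimple.

Let integral_nu_nnsfun (h : {nnsfun (measurableTypeR R) >-> R}) :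
  (\int[nu mU]_x (h x)%:E = \int[leb]_x ((h x)%:E * (expR (- U x))%:E))%E.
Proof.
have rh0 r : r \in range h -> 0 <= r by rewrite inE => -[t _ <-].
have mind r : measurable (h @^-1` [set r] : set (measurableTypeR R)).
  by rewrite -[X in measurable X]setTI; exact: measurable_funPT.
transitivity (\sum_(r \in range h) r%:E * nu mU (h @^-1` [set r]))%E.
  transitivity (\int[nu mU]_x (\sum_(r \in range h)
      (r * \1_(h @^-1` [set r]) x)%:E))%E.
    by apply: eq_integral => x _; rewrite fimfunE -fsumEFin.
  rewrite ge0_integral_fsum//.
  - apply: eq_fsbigr => r rh.
    under eq_integral do rewrite EFinM.
    rewrite ge0_integralZl ?lee_fin ?rh0//.
      by rewrite integral_indic ?setIT//; exact: mind.
    by apply/measurable_EFinP; apply: measurable_indic; exact: mind.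
  - move=> r; apply/measurable_EFinP; apply: measurable_funM => //.
    by apply: measurable_indic; exact: mind.
  - by move=> r x _; rewrite EFinM; exact: nnfun_muleindic_ge0.
transitivity (\int[leb]_x (\sum_(r \in range h)
    (r * \1_(h @^-1` [set r]) x)%:E * (expR (- U x))%:E))%E; last first.
  apply: eq_integral => x _; rewrite -ge0_mule_fsuml; last first.
    by move=> r; rewrite EFinM; exact: nnfun_muleindic_ge0.
  by rewrite [in RHS]fimfunE -fsumEFin.
have mi r : measurable_fun (setT : set (measurableTypeR R))
    (fun x => (\1_(h @^-1` [set r]) x : R)%:E).
  by apply/measurable_EFinP; exact: measurable_indic.
rewrite ge0_integral_fsum//; last 2 first.
- move=> r; apply: emeasurable_funM => //; apply/measurable_EFinP.
  by apply: measurable_funM => //; exact: measurable_indic.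
- move=> r x _; rewrite mule_ge0 ?lee_fin ?expR_ge0//.
  by rewrite -lee_fin EFinM; exact: nnfun_muleindic_ge0.
apply: eq_fsbigr => r rh; rewrite /nu [X in (_ * X)%E]integral_mkcond.
under [in RHS]eq_integral do rewrite EFinM -muleA.
rewrite ge0_integralZl ?lee_fin ?rh0//; last exact: emeasurable_funM.
congr (_ * _)%E; apply: eq_integral => x _.
by rewrite patchE indicE; case: (x \in _); rewrite ?mul1e ?mul0e.
Qed.

(** nu is given by its values on sets, which settles simple functions; monotone convergence does the
    rest. *)
Lemma ge0_integral_nu (f : R -> \bar R) : measurable_fun [set: R] f ->
  (forall x, 0 <= f x)%E ->
  (\int[nu mU]_x f x = \int[leb]_x (f x * (expR (- U x))%:E))%E.
Proof.
move=> mf f0; have mf' : measurable_fun (setT : set (measurableTypeR R)) f by [].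
pose h := nnsfun_approx measurableT mf'.
have hf x : (h n x)%:E @[n --> \oo] --> f x by exact: cvg_nnsfun_approx.
have nd x m n : (m <= n)%N -> ((h m x)%:E <= (h n x)%:E)%E.
  by move=> mn; rewrite lee_fin; exact/lefP/nd_nnsfun_approx.
have e0 x : (0 <= (expR (- U x))%:E)%E by rewrite lee_fin expR_ge0.
have mh n : measurable_fun (setT : set (measurableTypeR R)) (fun x => (h n x)%:E).
  exact/measurable_EFinP.
transitivity (limn (fun n => \int[nu mU]_x (h n x)%:E))%E.
  rewrite -monotone_convergence//.
  - by apply: eq_integral => x _; apply/esym/cvg_lim => //; exact: hf.
  - by move=> n x _; rewrite lee_fin.
  - by move=> x _ m n; exact: nd.
under eq_fun do rewrite integral_nu_nnsfun.
rewrite -monotone_convergence//.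
- apply: eq_integral => x _; apply/cvg_lim => //.
  by apply: cvgeZr => //; exact: hf.
- by move=> n; exact: emeasurable_funM.
- by move=> n x _; rewrite mule_ge0// lee_fin.
- by move=> x _ m n mn; rewrite lee_wpmul2r//; exact: nd.
Qed.

Lemma ae_nu (P : R -> Prop) : {ae leb, forall x, P x} ->
  {ae nu mU, forall x, P x}.
Proof.
move=> [N [mN N0 PN]]; exists N; split=> //.
by rewrite /nu; apply: null_set_integral => //; exact: measurable_funTS.
Qed.

(** mu is the sum of the images of nu under the two inclusions of the line as a sheet of the state
    space. *)
Lemma ge0_integral_mu (f : zzE R -> \bar R) : measurable_fun [set: zzE R] f ->
  (forall p, 0 <= f p)%E ->
  (\int[mu mU]_p f p = \int[nu mU]_x f (x, true) + \int[nu mU]_x f (x, false))%E.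
Proof.
move=> mf f0.
pose i s : R -> zzE R := pair^~ s.
have mi s : measurable_fun [set: R] (i s) by exact: pair2_measurable.
have E s : (\int[nu mU]_x f (x, s) = \int[pushforward (nu mU) (i s)]_p f p)%E.
  by rewrite (ge0_integral_pushforward (mi s)).
rewrite !E -ge0_integral_measure_add//.
have muE (B : set (zzE R)) : mu mU B =
    (nu mU [set x | B (x, true)] + nu mU [set x | B (x, false)])%E.
  by rewrite /mu big_bool.
apply: eq_measure_integral => A mA _; apply/esym/(etrans (measure_addE _ _ A)).
by apply/esym; exact: muE.
Qed.

End zigzag_measures.

(** * Complex-valued functions *)

Section complex_bridges.
Context {R : realType}.
Local Notation leb := (@lebesgue_measure R).
Implicit Types (c : R) (f g d : R -> R[i]).

Definition Ref f : R -> R := fun x => complex.Re (f x).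
Definition Imf f : R -> R := fun x => complex.Im (f x).

Lemma normc_sqr (z : R[i]) : Normc.normc z ^+ 2 = complex.Re z ^+ 2 + complex.Im z ^+ 2.
Proof. by case: z => a b /=; rewrite sqr_sqrtr// addr_ge0 ?sqr_ge0. Qed.

Lemma ReZ c (z : R[i]) : complex.Re (c%:C * z) = c * complex.Re z.
Proof. by case: z => a b /=; rewrite mul0r subr0. Qed.

Lemma ImZ c (z : R[i]) : complex.Im (c%:C * z) = c * complex.Im z.
Proof. by case: z => a b /=; rewrite mul0r addr0. Qed.

Lemma ReD (z w : R[i]) : complex.Re (z + w) = complex.Re z + complex.Re w.
Proof. by case: z; case: w. Qed.

Lemma ImD (z w : R[i]) : complex.Im (z + w) = complex.Im z + complex.Im w.
Proof. by case: z; case: w. Qed.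

Lemma ReN (z : R[i]) : complex.Re (- z) = - complex.Re z.
Proof. by case: z. Qed.

Lemma ImN (z : R[i]) : complex.Im (- z) = - complex.Im z.
Proof. by case: z. Qed.

(** Test functions are real, so the defining identity splits into its real and imaginary parts. *)
Lemma is_weak_derivativeP f g : is_weak_derivative f g <->
  real_weak_derivative (Ref f) (Ref g) /\ real_weak_derivative (Imf f) (Imf g).
Proof.
have P (h k : R -> R[i]) (phi : R -> R) :
    cintegral leb (fun x => h x * ((phi^`())%classic x)%:C) =
    - cintegral leb (fun x => k x * (phi x)%:C) <->
    (\int[leb]_x (Ref h x * (phi^`())%classic x) =
      - (\int[leb]_x (Ref k x * phi x))) /\
    (\int[leb]_x (Imf h x * (phi^`())%classic x) =
      - (\int[leb]_x (Imf k x * phi x))).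
  have E (l : R -> R[i]) (q : R -> R) : cintegral leb (fun x => l x * (q x)%:C) =
      (\int[leb]_x (Ref l x * q x)) +i* (\int[leb]_x (Imf l x * q x)).
    by congr (_ +i* _); apply: eq_Rintegral => x _; rewrite mulrC ?ReZ ?ImZ mulrC.
  rewrite !E; split=> [/eqP|[-> ->]] //.
  by rewrite eq_complex/= => /andP[/eqP -> /eqP ->].
split=> [[[lrf lif] [lrg lig] H]|[[lrf lrg Hr] [lif lig Hi]]].
  by split; split=> // phi /H /P[].
by split=> // phi tphi; apply/P; split; [exact: Hr|exact: Hi].
Qed.

Lemma is_weak_derivativeD f g f' g' : is_weak_derivative f g ->
  is_weak_derivative f' g' ->
  is_weak_derivative (fun x => f x + f' x) (fun x => g x + g' x).
Proof.
move=> /is_weak_derivativeP[r i] /is_weak_derivativeP[r' i'].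
apply/is_weak_derivativeP; split.
  have := real_weak_derivativeD r r'.
  by congr real_weak_derivative; apply/funext => x; rewrite /Ref ReD.
have := real_weak_derivativeD i i'.
by congr real_weak_derivative; apply/funext => x; rewrite /Imf ImD.
Qed.

Lemma is_weak_derivativeZ c f g : is_weak_derivative f g ->
  is_weak_derivative (fun x => c%:C * f x) (fun x => c%:C * g x).
Proof.
move=> /is_weak_derivativeP[r i]; apply/is_weak_derivativeP; split.
  have := real_weak_derivativeZ c r.
  by congr real_weak_derivative; apply/funext => x; rewrite /Ref ReZ.
have := real_weak_derivativeZ c i.
by congr real_weak_derivative; apply/funext => x; rewrite /Imf ImZ.
Qed.

Lemma is_weak_derivative_opp f g : is_weak_derivative f g ->
  is_weak_derivative (fun x => f (- x)) (fun x => - g (- x)).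
Proof.
move=> /is_weak_derivativeP[r i]; apply/is_weak_derivativeP; split.
  have := real_weak_derivative_opp r.
  by congr real_weak_derivative; apply/funext => x; rewrite /Ref ReN.
have := real_weak_derivative_opp i.
by congr real_weak_derivative; apply/funext => x; rewrite /Imf ImN.
Qed.

Lemma is_weak_derivative_unique f g g' : is_weak_derivative f g ->
  is_weak_derivative f g' -> {ae leb, forall x, g x = g' x}.
Proof.
move=> /is_weak_derivativeP[r i] /is_weak_derivativeP[r' i'].
apply: ae_lebesgueS (ae_lebesgueI (real_weak_derivative_unique r r')
  (real_weak_derivative_unique i i')) => x [].
by rewrite /Ref /Imf; case: (g x) => a b; case: (g' x) => a' b' /= -> ->.
Qed.

Lemma weak_derivativeP f g : is_weak_derivative f g ->
  is_weak_derivative f (weak_derivative f).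
Proof. by move=> fg; apply: (xgetPex (fun=> 0)); exists g. Qed.

End complex_bridges.

(** * Square integrability with respect to nu and mu *)

Section L2_spaces.
Context {R : realType} (U : R -> R) (hU : Cn 2 U).
Local Notation leb := (@lebesgue_measure R).
Local Notation mU := (Cn_measurable hU).
Implicit Types (c : R) (f g d : R -> R[i]).

Lemma L2_nuP f : L2 (nu mU) f <->
  weighted_L2 U (Ref f) /\ weighted_L2 U (Imf f).
Proof.
have mw : measurable_fun [set: R] (fun x => expR (- U x)).
  exact: continuous_measurable_fun (continuous_expRN hU).
have E : measurable_fun [set: R] (Ref f) -> measurable_fun [set: R] (Imf f) ->
    (\int[nu mU]_x (Normc.normc (f x) ^+ 2)%:E =
     \int[leb]_x ((Ref f x ^+ 2 * expR (- U x) + Imf f x ^+ 2 * expR (- U x)))%:E)%E.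
  move=> mr mi; rewrite ge0_integral_nu; last 2 first.
  - apply/measurable_EFinP; under eq_fun do rewrite normc_sqr.
    by apply: measurable_funD; exact: measurable_funX.
  - by move=> x; rewrite lee_fin sqr_ge0.
  by apply: eq_integral => x _; rewrite -EFinM normc_sqr mulrDl.
split=> [[[mr mi]]|[[mr ir] [mi ii]]].
  rewrite E// => foo.
  have irs : leb.-integrable setT (EFin \o (fun x =>
      Ref f x ^+ 2 * expR (- U x) + Imf f x ^+ 2 * expR (- U x))).
    apply/integrableP; split.
      apply/measurable_EFinP; apply: measurable_funD; apply: measurable_funM => //;
      exact: measurable_funX.
    move: foo; congr (_ < _)%E; apply: eq_integral => x _.
    by rewrite /= ger0_norm// addr_ge0// mulr_ge0 ?sqr_ge0 ?expR_ge0.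
  by split; apply: (weighted_L2_le hU _ irs) => // x; rewrite ?lerDl ?lerDr
    mulr_ge0 ?sqr_ge0 ?expR_ge0.
split=> //; rewrite E//.
have [_] := integrableP _ _ _ (integrable_add measurableT ir ii).
congr (_ < _)%E; apply: eq_integral => x _.
by rewrite /= ger0_norm// addr_ge0// mulr_ge0 ?sqr_ge0 ?expR_ge0.
Qed.

Lemma L2_muP (F : zzE R -> R[i]) : L2 (mu mU) F <->
  forall s, L2 (nu mU) (slice F s).
Proof.
have ms (G : zzE R -> R) : measurable_fun [set: zzE R] G <->
    forall s, measurable_fun [set: R] (fun x => G (x, s)).
  split=> [mG s|mG]; first exact: (measurableT_comp mG (pair2_measurable s)).
  rewrite (_ : G = fun p => if p.2 then G (p.1, true) else G (p.1, false)); last first.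
    by apply/funext => -[x []].
  apply: measurable_fun_ifT; first exact: measurable_snd.
    exact: (measurableT_comp (mG true) measurable_fst).
  exact: (measurableT_comp (mG false) measurable_fst).
have E : cmeasurable setT F -> (\int[mu mU]_p (Normc.normc (F p) ^+ 2)%:E =
    \int[nu mU]_x (Normc.normc (F (x, true)) ^+ 2)%:E +
    \int[nu mU]_x (Normc.normc (F (x, false)) ^+ 2)%:E)%E.
  move=> [mr mi]; rewrite ge0_integral_mu//.
    apply/measurable_EFinP; under eq_fun do rewrite normc_sqr.
    by apply: measurable_funD; exact: measurable_funX.
  by move=> p; rewrite lee_fin sqr_ge0.
have I0 s : (0 <= \int[nu mU]_x (Normc.normc (F (x, s)) ^+ 2)%:E)%E.
  by apply: integral_ge0 => x _; rewrite lee_fin sqr_ge0.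
split=> [[mF] |H].
  rewrite E// => foo s; have [mr mi] := mF; split.
    by split; [exact: (ms _).1 mr s|exact: (ms _).1 mi s].
  apply: le_lt_trans foo; case: s; rewrite ?leeDl ?leeDr//; exact: I0.
have mF : cmeasurable setT F.
  by split; apply/ms => s; have [[]] := H s.
split=> //; rewrite E//.
by apply: lte_add_pinfty; [have [] := H true|have [] := H false].
Qed.

Lemma L2_nuD f g : L2 (nu mU) f -> L2 (nu mU) g ->
  L2 (nu mU) (fun x => f x + g x).
Proof.
move=> /L2_nuP[fr fi] /L2_nuP[gr gi]; apply/L2_nuP; split.
  have := weighted_L2D hU fr gr.
  by congr weighted_L2; apply/funext => x; rewrite /Ref ReD.
have := weighted_L2D hU fi gi.
by congr weighted_L2; apply/funext => x; rewrite /Imf ImD.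
Qed.

Lemma L2_nuZ c f : L2 (nu mU) f -> L2 (nu mU) (fun x => c%:C * f x).
Proof.
move=> /L2_nuP[fr fi]; apply/L2_nuP; split.
  have := weighted_L2Z c fr.
  by congr weighted_L2; apply/funext => x; rewrite /Ref ReZ.
have := weighted_L2Z c fi.
by congr weighted_L2; apply/funext => x; rewrite /Imf ImZ.
Qed.

Lemma L2_nu_ae f g : L2 (nu mU) f -> L1loc g ->
  {ae leb, forall x, f x = g x} -> L2 (nu mU) g.
Proof.
move=> /L2_nuP[fr fi] [[mr _ _] [mi _ _]] fg; apply/L2_nuP; split.
  by apply: (weighted_L2_ae hU fr mr); apply: ae_lebesgueS fg => x; rewrite /Ref => ->.
by apply: (weighted_L2_ae hU fi mi); apply: ae_lebesgueS fg => x; rewrite /Imf => ->.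
Qed.

(** The weight is removed by multiplying with [e^U], which is continuous and so bounded on compact
    sets. *)
Lemma L2_nu_loc f : L2 (nu mU) f -> L2loc f.
Proof.
move=> L2f; have [[mr mi] _] := L2f; have /L2_nuP[[_ ir] [_ ii]] := L2f.
split=> // K cK; split; first by split; apply: measurable_funTS.
have cE : continuous (fun x => expR (U x)).
  move=> x; apply: (@continuous_comp _ _ _ U expR); last exact: continuous_expR.
  exact: (Cn_continuous hU).
have /locally_integrableP : measurable_fun [set: R] (fun x => Normc.normc (f x) ^+ 2) /\
    forall b, leb.-integrable `[- b, b] (EFin \o (fun x => Normc.normc (f x) ^+ 2)).
  split=> [|b].
    under eq_fun do rewrite normc_sqr.
    by apply: measurable_funD; exact: measurable_funX.
  have i : leb.-integrable `[- b, b] (EFin \o (fun x =>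
      Ref f x ^+ 2 * expR (- U x) + Imf f x ^+ 2 * expR (- U x))).
    by apply: (@integrableS _ _ _ _ setT) => //; exact: integrable_add.
  have := integrable_continuousM i cE; apply: eq_integrable => // x _ /=.
  rewrite normc_sqr -mulrDl -mulrA -expRD addNr expR0 mulr1//.
move=> [_ _ /(_ K (subsetT _) cK)].
by congr (_ < _)%E; apply: eq_integral => x _; rewrite ger0_norm// sqr_ge0.
Qed.

Hypothesis U_even : forall x, U x = U (- x).

Lemma weighted_L2_opp (u : R -> R) : weighted_L2 U u ->
  weighted_L2 U (fun x => u (- x)).
Proof.
move=> [mu /integrable_opp[iu _]]; split.
  by apply: measurableT_comp => //; exact: measurable_oppr.
by move: iu; apply: eq_integrable => // x _ /=; rewrite -U_even.
Qed.

Lemma L2_nu_opp f : L2 (nu mU) f -> L2 (nu mU) (fun x => f (- x)).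
Proof.
move=> /L2_nuP[fr fi]; apply/L2_nuP.
by split; [exact: (weighted_L2_opp fr)|exact: (weighted_L2_opp fi)].
Qed.

End L2_spaces.

(** * The zigzag generator *)

Section zigzag_generator.
Context {R : realType} (U lrefr : R -> R) (delta a A c1 c2 : R).
Context (hU : Cn 2 U) (delta1 : delta < 1) (A0 : 0 < A).
Context (hddU : forall x, a <= (U^`(2))%classic x <=
                          delta * `|(U^`())%classic x| ^+ 2 + A).
Context (c10 : 0 <= c1) (c20 : 0 <= c2) (lrefr_cont : continuous lrefr).
Context (lrefr_ge0 : forall x, 0 <= lrefr x).
Context (lrefr_le : forall x, lrefr x <= c1 + c2 * `|(U^`())%classic x|).
Context (U_even : forall x, U x = U (- x)).
Context (lrefr_even : forall x, lrefr x = lrefr (- x)).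
Local Notation leb := (@lebesgue_measure R).
Local Notation mU := (Cn_measurable hU).
Local Notation U' := ((U^`())%classic).
Local Notation lam x := (lambda U lrefr (x, true)).

Lemma deriv_even x : U' (- x) = - U' x.
Proof.
have dU : derivable U (-1 * x + 0) 1 by exact: Cn_derivable hU.
have [_] := is_derive_comp_affine dU.
rewrite (_ : (fun y => _) = U); last first.
  by apply/funext => y; rewrite addr0 mulN1r -U_even.
by rewrite -derive1E addr0 !mulN1r => ->; rewrite opprK.
Qed.

(** [U'] is odd, and a number is its positive part minus the positive part of its opposite; the even
    [lrefr] cancels. *)
Lemma lambda_opp x : lam x - lam (- x) = U' x.
Proof.
rewrite /lambda /sgn /= !mul1r deriv_even -lrefr_even.
by case: (leP (U' x) 0); case: (leP (- U' x) 0); lra.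
Qed.

(** The symmetry behind the decoupling: [T] reflects the sheet -1, and after reflection both sheets
    carry the same rate. *)
Lemma lambda_flip x : lambda U lrefr (- x, false) = lam x.
Proof. by rewrite /lambda /sgn /= -lrefr_even deriv_even mul1r mulN1r opprK. Qed.

Lemma lambda_norm_le x : `|lam x| <= (1 + c2) * `|U' x| + c1.
Proof.
rewrite ger0_norm; last by rewrite addr_ge0// le_max lexx orbT.
rewrite /lambda /sgn /= mul1r.
have : Num.max (U' x) 0 <= `|U' x| by rewrite ge_max ler_norm normr_ge0.
by have := lrefr_le x; lra.
Qed.

Lemma measurable_lambda : measurable_fun [set: R] (fun x => lam x).
Proof.
have mU' : measurable_fun [set: R] U'.
  by apply: continuous_measurable_fun; have /CnS[_ /Cn_continuous] := hU.
apply: measurable_funD; last exact: continuous_measurable_fun.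
by apply: measurable_maxr => //; exact: measurable_funM.
Qed.

(** The growth bound on [lrefr] makes [lambda] at most affine in [|U'|]. *)
Lemma weighted_L2_lambda (u : R -> R) : weighted_L2 U u ->
  weighted_L2 U (fun x => U' x * u x) -> weighted_L2 U (fun x => lam x * u x).
Proof.
move=> u2 Uu2; have [mu _] := u2; have [mUu _] := Uu2.
have norm2 w : weighted_L2 U w -> weighted_L2 U (fun x => `|w x|).
  move=> w2; have [mw _] := w2; apply: (weighted_L2_dom hU w2) => [|x].
    exact: measurableT_comp.
  by rewrite normr_id.
have q2 := weighted_L2D hU (weighted_L2Z (1 + c2) (norm2 _ Uu2))
  (weighted_L2Z c1 (norm2 _ u2)).
apply: (weighted_L2_dom hU q2) => [|x].
  by apply: measurable_funM => //; exact: measurable_lambda.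
rewrite [leRHS]ger0_norm; last by rewrite addr_ge0// mulr_ge0// addr_ge0.
rewrite !normrM mulrA -mulrDl ler_wpM2r//; exact: lambda_norm_le.
Qed.

(* For sigma = 1 (resp. -1), [o] is twice the odd (resp. even) part of [u], and
   [h + sigma h(-.) = o' - U' o]: the even coefficients of lambda cancel. *)
Lemma weighted_L2_generator (sigma : R) (u v : R -> R) : sigma * sigma = 1 ->
  real_weak_derivative u v -> weighted_L2 U u ->
  weighted_L2 U v <->
  weighted_L2 U (fun x => v x + lam x * (sigma * u (- x) - u x)).
Proof.
move=> ss uv u2; have [_ [mv _ _] _] := uv.
pose o x := u x + - sigma * u (- x); pose o' x := v x + - sigma * - v (- x).
pose h x := v x + lam x * (sigma * u (- x) - u x).
have oo' : real_weak_derivative o o'.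
  exact: (real_weak_derivativeD uv
    (real_weak_derivativeZ (- sigma) (real_weak_derivative_opp uv))).
have o2 : weighted_L2 U o.
  exact: (weighted_L2D hU u2 (weighted_L2Z (- sigma) (weighted_L2_opp U_even u2))).
have hE x : h x = v x - lam x * o x by rewrite /h /o; ring.
rewrite -/h; split=> [v2|h2].
  have nv2 : weighted_L2 U (fun x => - v (- x)).
    have := weighted_L2Z (-1) (weighted_L2_opp U_even v2).
    by congr weighted_L2; apply/funext => x; rewrite mulN1r.
  have o'2 : weighted_L2 U o' by exact: (weighted_L2D hU v2 (weighted_L2Z _ nv2)).
  have Uo2 : weighted_L2 U (fun x => U' x * o x).
    apply: (weighted_L2_mul_deriv hU delta1 A0 _ oo' o2 o'2) => x.
    by have /andP[_] := hddU x; rewrite real_normK// num_real.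
  have := weighted_L2B hU v2 (weighted_L2_lambda o2 Uo2).
  by congr weighted_L2; apply/funext => x; rewrite hE.
have e2 : weighted_L2 U (fun x => o' x - U' x * o x).
  have := weighted_L2D hU h2 (weighted_L2Z sigma (weighted_L2_opp U_even h2)).
  congr weighted_L2; apply/funext => x; rewrite -lambda_opp !hE /o /o' opprK.
  move: (lam x) (lam (- x)) (u x) (u (- x)) (v x) (v (- x)) => l m p q s t.
  rewrite (_ : sigma * (t - m * (q + - sigma * p)) =
    sigma * t - m * (sigma * q - sigma * sigma * p)); last by ring.
  by rewrite ss; ring.
have o'2 : weighted_L2 U o'.
  apply: (weighted_L2_deriv (a := a) hU _ oo' o2 e2) => x.
  by have /andP[] := hddU x.
have Uo2 : weighted_L2 U (fun x => U' x * o x).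
  have := weighted_L2B hU o'2 e2.
  by congr weighted_L2; apply/funext => x; rewrite opprB addrC subrK.
have := weighted_L2D hU h2 (weighted_L2_lambda o2 Uo2).
by congr weighted_L2; apply/funext => x; rewrite hE subrK.
Qed.

(** The coefficients are real, so the real equivalence applies to each part separately. *)
Lemma L2_nu_generator s (f d : R -> R[i]) : is_weak_derivative f d ->
  L2 (nu mU) f -> L2 (nu mU) d <->
  L2 (nu mU) (fun x => d x + (lam x)%:C * ((sgn s)%:C * f (- x) - f x)).
Proof.
move=> /is_weak_derivativeP[dr di] /L2_nuP[fr fi].
have ss : sgn s * sgn s = 1 :> R by case: s; rewrite /sgn ?mulr1// mulrNN mulr1.
have Hr := weighted_L2_generator ss dr fr.
have Hi := weighted_L2_generator ss di fi.
rewrite !L2_nuP.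
rewrite (_ : Ref (fun x => d x + _) =
  (fun x => Ref d x + lam x * (sgn s * Ref f (- x) - Ref f x))); last first.
  by apply/funext => x; rewrite /Ref ReD ReZ ReD ReZ ReN.
rewrite (_ : Imf (fun x => d x + _) =
  (fun x => Imf d x + lam x * (sgn s * Imf f (- x) - Imf f x))); last first.
  by apply/funext => x; rewrite /Imf ImD ImZ ImD ImZ ImN.
by rewrite Hr Hi.
Qed.

Local Notation r2 := (((Num.sqrt 2)^-1)%:C : R[i]).

Lemma sgnC s : (sgn s)%:C = (if s then 1 else -1) :> R[i].
Proof. by case: s; rewrite /sgn ?rmorphN1 ?rmorph1. Qed.

Lemma slice_TstarK (f : zzE R -> R[i]) s x : slice f s x =
  r2 * (slice (Tstar f) true x + (sgn s)%:C * slice (Tstar f) false (- x)).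
Proof. by rewrite -{1}(TstarK f). Qed.

Lemma slice_Tstar_true (f : zzE R -> R[i]) x : slice (Tstar f) true x =
  r2 * (slice f true x + 1%:C * slice f false x).
Proof. by rewrite /slice /Tstar /sgn /= mul1r. Qed.

Lemma slice_Tstar_false (f : zzE R -> R[i]) x : slice (Tstar f) false x =
  r2 * (slice f true (- x) + (-1)%:C * slice f false (- x)).
Proof. by rewrite /slice /Tstar /sgn /= mulN1r. Qed.

Lemma L2_mu_Tstar f : L2 (mu mU) f -> L2 (mu mU) (Tstar f).
Proof.
move=> /L2_muP f2; apply/L2_muP => -[].
  have := L2_nuZ (Num.sqrt 2)^-1 (L2_nuD (f2 true) (L2_nuZ 1 (f2 false))).
  by congr L2; apply/funext => x; rewrite slice_Tstar_true.
have := L2_nu_opp U_even (L2_nuZ (Num.sqrt 2)^-1 (L2_nuD (f2 true) (L2_nuZ (-1) (f2 false)))).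
by congr L2; apply/funext => x; rewrite slice_Tstar_false.
Qed.

Lemma L2_mu_T f : L2 (mu mU) f -> L2 (mu mU) (T f).
Proof.
move=> /L2_muP f2; apply/L2_muP => s.
exact: (L2_nuZ (Num.sqrt 2)^-1 (L2_nuD (f2 true) (L2_nuZ (sgn s) (L2_nu_opp U_even (f2 false))))).
Qed.

(** What differentiating [f = T (Tstar f)] gives; the inner minus sign comes from the reflection of
    the sheet -1. *)
Definition T_deriv (f : zzE R -> R[i]) s : R -> R[i] := fun x =>
  r2 * (weak_derivative (slice (Tstar f) true) x +
        (sgn s)%:C * - weak_derivative (slice (Tstar f) false) (- x)).

(** A pointwise identity without regularity of [f]: [T_deriv] is built from the same chosen
    derivatives as [zzL] of [Tstar f], so only algebra and the common rate are involved. *)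
Lemma slice_zzLt f s x : slice (zzLt U lrefr f) s x =
  T_deriv f s x +
  (lam x)%:C * ((sgn s)%:C * slice f s (- x) - slice f s x).
Proof.
have -> : slice (zzLt U lrefr f) s x = r2 * (zzL U lrefr (Tstar f) (x, true) +
    (sgn s)%:C * zzL U lrefr (Tstar f) (- x, false)) by [].
have -> : zzL U lrefr (Tstar f) (x, true) =
    weak_derivative (slice (Tstar f) true) x +
    (lam x)%:C * (slice (Tstar f) false x - slice (Tstar f) true x).
  by rewrite /zzL /= rmorph1 mul1r.
have -> : zzL U lrefr (Tstar f) (- x, false) =
    - weak_derivative (slice (Tstar f) false) (- x) +
    (lam x)%:C * (slice (Tstar f) true (- x) - slice (Tstar f) false (- x)).
  by rewrite /zzL /= rmorphN1 mulN1r lambda_flip.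
rewrite !(slice_TstarK f) opprK /T_deriv.
rewrite !sgnC; case: s => /=; ring.
Qed.

Lemma is_weak_derivative_T f :
  (forall s, exists g, is_weak_derivative (slice (Tstar f) s) g) ->
  forall s, is_weak_derivative (slice f s) (T_deriv f s).
Proof.
move=> H s; have [g1 /weak_derivativeP H1] := H true.
have [g2 /weak_derivativeP H2] := H false.
have := is_weak_derivativeZ (Num.sqrt 2)^-1 (is_weak_derivativeD H1
  (is_weak_derivativeZ (sgn s) (is_weak_derivative_opp H2))).
by congr is_weak_derivative; apply/funext => x; rewrite (slice_TstarK f).
Qed.

(** Weak differentiability passes between [f] and [Tstar f] by linear combinations and reflection.
    Global square integrability is exchanged between the derivative and the generator by
    [L2_nu_generator]. *)
Lemma zzLtdomE : zzLtdom lrefr mU = W12 mU.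
Proof.
apply/seteqP; split=> f.
  move=> [f2 [_ Tf L2L]] s; have fs2 := (L2_muP hU f).1 f2 s.
  have H t : exists g, is_weak_derivative (slice (Tstar f) t) g.
    by have [_ [g [? _]]] := Tf t; exists g.
  have fd := is_weak_derivative_T H s; split=> //; exists (T_deriv f s); split=> //.
  apply/(L2_nu_generator s fd fs2).
  have := (L2_muP hU _).1 (L2_mu_T L2L) s.
  by congr L2; apply/funext => x; rewrite -[LHS]/(slice (zzLt U lrefr f) s x) slice_zzLt.
move=> fW; have f2 : L2 (mu mU) f by apply/L2_muP => s; have [] := fW s.
have g2 := L2_mu_Tstar f2.
have [_ [d1 [fd1 d12]]] := fW true; have [_ [d2 [fd2 d22]]] := fW false.
have gd : forall s, exists g, is_weak_derivative (slice (Tstar f) s) g /\ L2loc g.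
  case.
    exists (fun x => r2 * (d1 x + 1%:C * d2 x)); split.
      have := is_weak_derivativeZ (Num.sqrt 2)^-1
        (is_weak_derivativeD fd1 (is_weak_derivativeZ 1 fd2)).
      by congr is_weak_derivative; apply/funext => x; rewrite slice_Tstar_true.
    exact: (L2_nu_loc (L2_nuZ _ (L2_nuD d12 (L2_nuZ 1 d22)))).
  exists (fun x => - (r2 * (d1 (- x) + (-1)%:C * d2 (- x)))); split.
    have := is_weak_derivative_opp (is_weak_derivativeZ (Num.sqrt 2)^-1
      (is_weak_derivativeD fd1 (is_weak_derivativeZ (-1) fd2))).
    by congr is_weak_derivative; apply/funext => x; rewrite slice_Tstar_false.
  have := L2_nu_loc (L2_nuZ (-1) (L2_nu_opp U_even
    (L2_nuZ (Num.sqrt 2)^-1 (L2_nuD d12 (L2_nuZ (-1) d22))))).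
  by congr L2loc; apply/funext => x; rewrite rmorphN1 mulN1r.
have fT := is_weak_derivative_T (fun s => let: ex_intro g (conj H _) := gd s in
  ex_intro _ g H).
split=> //; split=> //.
  by move=> s; split; [exact: (L2_nu_loc ((L2_muP hU _).1 g2 s))|exact: gd].
(* Since [Tstar] preserves L^2(mu), it is enough to treat the conjugated operator, whose components
   are decoupled. *)
rewrite -(TK (zzL U lrefr (Tstar f))); apply: L2_mu_Tstar; apply/L2_muP => s.
have [fs2 [d [fd ds2]]] := fW s.
have [_ lT _] := fT s.
(* The given weak derivative [d] is square integrable, and [T_deriv] agrees with it almost
   everywhere. *)
have T2 := L2_nu_ae ds2 lT (is_weak_derivative_unique fd (fT s)).
have := (L2_nu_generator s (fT s) fs2).1 T2.
by congr L2; apply/funext => x; rewrite -slice_zzLt.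
Qed.

(** [T_deriv] and the chosen derivative of the slice are two weak derivatives of one function, hence
    equal only up to a Lebesgue null set, which is also null for nu. *)
Lemma zzLt_ae f : zzLtdom lrefr mU f -> forall s,
  {ae nu mU, forall x, slice (zzLt U lrefr f) s x =
    weak_derivative (slice f s) x +
    (lam x)%:C * ((sgn s)%:C * slice f s (- x) - slice f s x)}.
Proof.
move=> [_ [_ Tf _]] s; apply: ae_nu.
have H t : exists g, is_weak_derivative (slice (Tstar f) t) g.
  by have [_ [g [? _]]] := Tf t; exists g.
have fd := is_weak_derivative_T H s.
apply: ae_lebesgueS (is_weak_derivative_unique fd (weak_derivativeP fd)) => x dx.
by rewrite slice_zzLt dx.
Qed.

End zigzag_generator.

Theorem proposition5p2 (R : realType) (U lrefr : R -> R)
  (delta a A c1 c2 : R)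
  (hU : Cn 2 U)
  (hint : (@lebesgue_measure R).-integrable setT (fun x => (expR (- U x))%:E))
  (hdelta : 0 < delta < 1)
  (hA : 0 < A)
  (hddU : forall x, a <= (U^`(2))%classic x <=
                      delta * `|(U^`())%classic x| ^+ 2 + A)
  (hc1 : 0 <= c1) (hc2 : 0 <= c2)
  (hlrefr_cont : continuous lrefr)
  (hlrefr_ge0 : forall x, 0 <= lrefr x)
  (hlrefr : forall x, lrefr x <= c1 + c2 * `|(U^`())%classic x|)
  (hU_even : forall x, U x = U (- x))
  (hlrefr_even : forall x, lrefr x = lrefr (- x)) :
  zzLtdom lrefr (Cn_measurable hU) = W12 (Cn_measurable hU) /\
  (forall f, zzLtdom lrefr (Cn_measurable hU) f ->
   forall s : bool,
   {ae nu (Cn_measurable hU), forall x,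
     slice (zzLt U lrefr f) s x =
     weak_derivative (slice f s) x +
     (lambda U lrefr (x, true))%:C *
       ((sgn s)%:C * slice f s (- x) - slice f s x)}).
Proof.
have /andP[_ delta1] := hdelta; split=> [|f fdom s]; last exact: zzLt_ae.
exact: (zzLtdomE hU delta1 hA hddU hc1 hc2 hlrefr_cont hlrefr_ge0 hlrefr hU_even
  hlrefr_even).
Qed.
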